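(* Let $\mathsf{M}$ be a loopless polymatroid and $\mathcal{G}$ a building set on $\mathcal{L}(\mathsf{M})$. In the incidence algebra $\mathcal{I}$ of $\mathcal{L}(\mathsf{M})$, the $\mathcal{G}$-Chow function and the $\mathcal{G}$-reduced characteristic function are inverse up to sign: $\mathrm{H}^{\mathcal{G}}=-\left(\overline{\chi}^{\mathcal{G}}\right)^{-1}$.
   Context: A polymatroid $\mathsf{M}=(E,\operatorname{rk})$: finite $E$, $\operatorname{rk}:2^E\to\mathbb{Z}_{\ge0}$ with $\operatorname{rk}(\varnothing)=0$, monotone, submodular. Flats: $F$ with $\operatorname{rk}(F\cup\{e\})>\operatorname{rk}(F)$ for $e\notin F$; lattice $\mathcal L(\mathsf{M})$ with join $\vee$; loopless: $\varnothing$ is a flat. $f(\mathcal{G})$ = inclusion-maximal elements of a set $\mathcal{G}$ of flats; $\mathcal{G}_{\le F}=\{G\in\mathcal{G}:G\subseteq F\}$. A building set is $\mathcal{G}\subseteq\mathcal L(\mathsf{M})\setminus\{\varnothing\}$ such that for every flat $F$ the map $\prod_{G\in f(\mathcal{G}_{\le F})}[\varnothing,G]\to[\varnothing,F]$, $(F_G)\mapsto\bigvee F_G$, is a lattice isomorphism and $\operatorname{rk}(F)=\sum_{G\in f(\mathcal{G}_{\le F})}\operatorname{rk}(G)$. For flats $F\subsetneq G$, the minor $\mathsf{M}|_G/F$ is the polymatroid on $G\setminus F$ with rank $A\mapsto\operatorname{rk}(A\cup F)-\operatorname{rk}(F)$, lattice of flats identified with $[F,G]$, with induced building set $\mathcal{G}|_G/F=\{H\vee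 F:H\in\mathcal{G},H\subseteq G,H\not\subseteq F\}$. Characteristic polynomial: $\chi_\mathsf{N}(x)=\sum_{F\in\mathcal L(\mathsf{N})}\mu(\varnothing,F)x^{\operatorname{rk}(\text{ground set})-\operatorname{rk}(F)}$. The Chow ring $D(\mathsf{N},\mathcal{B})$ of a polymatroid $\mathsf{N}$ with building set $\mathcal{B}$ is $\mathbb{Q}[x_B:B\in\mathcal{B}]$ (degree-1 generators) modulo the ideal generated by $\big(\prod_{i=1}^m x_{B_i}\big)\big(\sum_{H\in\mathcal{B},H\supseteq B}x_H\big)^{\operatorname{rk}(B)-\operatorname{rk}(\sup(S,B))}$ for each subset $S=\{B_1,\dots,B_m\}\subseteq\mathcal{B}$ and $B\in\mathcal{B}$, with $\sup(S,B)=\bigvee_{B'\in S,B'\subsetneq B}B'$; $\mathrm{H}^{\mathcal{B}}_\mathsf{N}(x)$ is its Hilbert series. The incidence algebra $\mathcal{I}$ consists of functions $a$ assigning to each pair of flats $F\subseteq G$ an element $a_{FG}\in\mathbb{Q}(x)$, with product $(a\cdot b)_{FG}=\sum_{H\in[F,G]}a_{FH}b_{HG}$ and identity $\delta$ ($\delta_{FF}=1$, $\delta_{FG}=0$ for $F\ne G$). Define $\overline{\chi}^{\mathcal{G}}_{FF}=-1$, $\overline{\chi}^{\mathcal{G}}_{FG}=-\chi_{\mathsf{M}|_G/F}(x)/(1-x)^{|f(\mathcal{G}|_G/F)|}$ for $F\subsetneq G$; and $\mathrm{H}^{\mathcal{G}}_{FF}=1$, $\mathrm{H}^{\mathcal{G}}_{FG}=\mathrm{H}^{\mathcal{G}|_G/F}_{\mathsf{M}|_G/F}(x)$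 for $F\subsetneq G$. *)

(* Defs.v *)
From HB Require Import structures.
From mathcomp Require Import all_boot all_order all_algebra.
From mathcomp Require Import fraction boolp mpoly.

Set Implicit Arguments.
Unset Strict Implicit.
Unset Printing Implicit Defensive.

Import GRing.Theory.

Local Open Scope ring_scope.

(* The ground set is a subset of the ambient finite type T, so that a         *)
(* polymatroid and all its minors have flats in the same type {set T}; the    *)
(* values of rk outside the subsets of gset are irrelevant.                   *)
Record rankData (T : finType) :=
  RankData { gset : {set T}; rk : {set T} -> nat }.

Section Polymatroid.
Variables (T : finType) (M : rankData T).
Implicit Types (A B F G H : {set T}) (GG : {set {set T}}).

Definition polymatroid : Prop :=
  [/\ rk M set0 = 0%N,
      forall A B, A \subset B -> B \subset gset M -> (rk M A <= rk M B)%N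
    & forall A B, A \subset gset M -> B \subset gset M ->
        (rk M (A :|: B) + rk M (A :&: B) <= rk M A + rk M B)%N].

Definition flat F : bool :=
  (F \subset gset M) && [forall e in gset M :\: F, (rk M F < rk M (e |: F))%N].

Definition loopless : bool := flat set0.

(* The least flat containing A (see flat_cl, sub_cl and cl_min below). The    *)
(* join of a family of flats is the closure of its union, the meet of two     *)
(* flats is their intersection (see flatI).                                   *)
Definition cl A : {set T} := \bigcap_(F | flat F && (A \subset F)) F.

Definition join F G : {set T} := cl (F :|: G).

Definition maxels GG : {set {set T}} :=
  [set G in GG | ~~ [exists H in GG, G \proper H]].

Definition below GG F : {set {set T}} := [set G in GG | G \subset F].

(* [set0, F] in the lattice of flats of a loopless polymatroid *)
Definition lower F : {set {set T}} := [set H | flat H & H \subset F].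

(* The product of the lower intervals [set0, G], G in GG: a family is a       *)
(* finite function which is set0 outside GG.                                  *)
Definition lower_prod GG : {set {ffun {set T} -> {set T}}} :=
  [set phi in pfamily set0 GG lower].

Definition join_fam GG (phi : {ffun {set T} -> {set T}}) : {set T} :=
  cl (\bigcup_(G in GG) phi G).

Definition join_fam_iso GG F : Prop :=
  [/\ {in lower_prod GG &, injective (join_fam GG)},
      [set join_fam GG phi | phi in lower_prod GG] = lower F,
      {in lower_prod GG &, forall phi psi : {ffun {set T} -> {set T}},
        join_fam GG [ffun G => phi G :&: psi G]
          = join_fam GG phi :&: join_fam GG psi}
    & {in lower_prod GG &, forall phi psi : {ffun {set T} -> {set T}},
        join_fam GG [ffun G => if G \in GG then join (phi G) (psi G) else set0]
          = join (join_fam GG phi) (join_fam GG psi)}].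

Definition building_set GG : Prop :=
  (forall G, G \in GG -> flat G /\ G != set0) /\
  (forall F, flat F ->
     join_fam_iso (maxels (below GG F)) F /\
     rk M F = (\sum_(G in maxels (below GG F)) rk M G)%N).

Fixpoint mobius_rec (n : nat) F G : int :=
  if F == G then 1
  else if n is n'.+1
       then - \sum_(H | [&& flat H, F \subset H & H \proper G])
                mobius_rec n' F H
       else 0.

(* The Moebius function of the lattice of flats; #|G| steps suffice for the   *)
(* usual recursion, see mobiusE.                                              *)
Definition mobius F G : int := mobius_rec #|G| F G.

Definition char_poly_pm : {poly rat} :=
  \sum_(F | flat F) (mobius set0 F)%:~R *: 'X^(rk M (gset M) - rk M F).

Lemma flatP F :
  reflect (F \subset gset M /\
           forall e, e \in gset M -> e \notin F -> (rk M F < rk M (e |: F))%N)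
          (flat F).
Proof.
apply: (iffP andP) => -[sF h]; split=> //.
  by move=> e eg eF; move/forall_inP: h; apply; rewrite inE eF.
by apply/forall_inP => e; rewrite inE => /andP[eF eg]; apply: h.
Qed.

Lemma flat_gset : flat (gset M).
Proof. by apply/flatP; split=> // e ->. Qed.

Lemma flatI F G : polymatroid -> flat F -> flat G -> flat (F :&: G).
Proof.
case=> _ mono subm; wlog suff key : F G / forall e, flat F -> flat G ->
    e \in gset M -> e \notin F -> (rk M (F :&: G) < rk M (e |: (F :&: G)))%N.
  move=> fF fG; have /flatP[sF _] := fF; apply/flatP; split.
    by apply: subset_trans sF; apply: subsetIl.
  move=> e eg; rewrite inE negb_and => /orP[eF|eG]; first exact: key.
  by rewrite setIC; apply: key.
move=> e /flatP[sF hF] /flatP[sG hG] eg eF.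
have sI : F :&: G \subset gset M by apply: subset_trans sF; apply: subsetIl.
have se : e |: F :&: G \subset gset M by rewrite subUset sub1set eg.
have := subm F (e |: F :&: G) sF se.
have -> : F :|: (e |: F :&: G) = e |: F by rewrite setUCA (setUidPl (subsetIl _ _)).
have -> : F :&: (e |: F :&: G) = F :&: G.
  apply/setP => x; rewrite !inE; case: eqVneq => [->|] /=.
    by rewrite (negPf eF).
  by rewrite andbA andbb.
have := hF e eg eF => h1 h2; rewrite ltnNge; apply/negP => h3.
have := leq_trans h2 (leq_add (leqnn _) h3).
by rewrite leq_add2r leqNgt h1.
Qed.

Lemma sub_cl A : A \subset cl A.
Proof. by apply/bigcapsP => F /andP[]. Qed.

Lemma cl_min A F : flat F -> A \subset F -> cl A \subset F.
Proof. by move=> fF AF; apply: bigcap_inf; rewrite fF. Qed.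

Lemma flat_cl A : polymatroid -> A \subset gset M -> flat (cl A).
Proof.
move=> pM sA; have -> : cl A = gset M :&: cl A.
  by apply/esym/setIidPr/cl_min => //; apply: flat_gset.
rewrite /cl; elim/big_rec: _ => [|F G /andP[fF _] fG].
  by rewrite setIT flat_gset.
by rewrite setICA; apply: flatI.
Qed.

Lemma mobiusE F G : F \subset G ->
  mobius F G = if F == G then 1 else
    - \sum_(H | [&& flat H, F \subset H & H \proper G]) mobius F H.
Proof.
have key n m F' G' : F' \subset G' -> (#|G'| <= n)%N -> (#|G'| <= m)%N ->
    mobius_rec n F' G' = mobius_rec m F' G'.
  elim: n m G' => [|n IHn] [|m] G' sFG //=.
  - rewrite leqn0 cards_eq0 => /eqP G0 _; move: sFG; rewrite G0 subset0.
    by move=> ->.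
  - move=> _; rewrite leqn0 cards_eq0 => /eqP G0; move: sFG.
    by rewrite G0 subset0 => ->.
  - move=> len lem; case: ifP => // _; congr (- _).
    apply: eq_bigr => H /and3P[_ sFH /proper_card lt].
    by apply: IHn; rewrite // -ltnS; apply: leq_trans lt _.
move=> sFG; rewrite /mobius; case def_n: #|G| => [|n] /=.
  move/eqP: def_n sFG; rewrite cards_eq0 => /eqP->.
  by rewrite subset0 => ->.
case: ifP => // _; congr (- _).
apply: eq_bigr => H /and3P[_ sFH /proper_card]; rewrite def_n ltnS => lt.
exact: key.
Qed.

End Polymatroid.

Section Minor.
Variables (T : finType) (M : rankData T).
Implicit Types (A F G H : {set T}) (GG : {set {set T}}).

(* minor F G is M|_G/F *)
Definition minor F G : rankData T :=
  RankData (G :\: F) (fun A => (rk M (A :|: F) - rk M F)%N).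

(* A flat H of [F, G] corresponds to the flat H :\: F of the minor. *)
Definition minor_building GG F G : {set {set T}} :=
  [set join M H F :\: F | H in GG & (H \subset G) && ~~ (H \subset F)].

Lemma minor_polymatroid F G :
  polymatroid M -> F \subset G -> G \subset gset M -> polymatroid (minor F G).
Proof.
move=> [rk0 mono subm] sFG sG; have sF := subset_trans sFG sG.
have sub A : A \subset G :\: F -> A :|: F \subset gset M.
  move=> sA; rewrite subUset sF andbT; apply: subset_trans sG.
  by apply: subset_trans sA _; apply: subsetDl.
split=> /= [|A B sAB sB|A B sA sB].
- by rewrite set0U subnn.
- by apply/leq_sub2r/mono; [apply: setSU | apply: sub].
- have hle (C : {set T}) : C \subset G :\: F -> (rk M F <= rk M (C :|: F))%N.
    by move=> sC; apply: mono; [apply: subsetUr | apply: sub].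
  have sAI : A :&: B \subset G :\: F.
    by apply: subset_trans sA; apply: subsetIl.
  have sAU : A :|: B \subset G :\: F by rewrite subUset sA.
  rewrite -(leq_add2r (rk M F + rk M F)) addnACA [leqRHS]addnACA !subnK ?hle //.
  by rewrite setUIl setUUl; apply: subm; apply: sub.
Qed.

Lemma flat_minor F G A :
    polymatroid M -> flat M F -> flat M G -> F \subset G ->
    A \subset G :\: F ->
  flat (minor F G) A = flat M (A :|: F).
Proof.
move=> [rk0 mono subm] /flatP[sF hF] /flatP[sG hG] sFG sA.
have sAG : A :|: F \subset G.
  by rewrite subUset sFG (subset_trans sA) ?subsetDl.
have sAM := subset_trans sAG sG.
have lt1 e : e \in gset M ->
    (rk M (A :|: F) - rk M F < rk M ((e |: A) :|: F) - rk M F)%N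
      = (rk M (A :|: F) < rk M (e |: (A :|: F)))%N.
  move=> eg; rewrite -setUA ltn_sub2rE //.
  by apply: mono => //; apply: subsetUr.
apply/flatP/flatP => /= -[_ h]; split=> // e.
  move=> eg eAF; case: (boolP (e \in G)) => eG.
    rewrite -lt1 //; apply: h.
      by rewrite inE eG andbT; apply: contra eAF; rewrite inE orbC => ->.
    by apply: contra eAF; rewrite inE => ->.
  have sI : G :&: (e |: (A :|: F)) = A :|: F.
    apply/setP => x; rewrite !inE.
    case: eqVneq => [->|_] /=; last first.
      rewrite -in_setU; apply/andP/idP => [[]//|xA]; split=> //.
      exact: (subsetP sAG).
    by move: eAF; rewrite (negPf eG) inE => /negPf ->.
  have := subm G (e |: (A :|: F)) sG; rewrite sI subUset sub1set eg sAM.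
  have -> : G :|: (e |: (A :|: F)) = e |: G.
    by rewrite setUCA (setUidPl sAG).
  move=> /(_ isT) h2; rewrite ltnNge; apply/negP => h3.
  have := leq_trans h2 (leq_add (leqnn _) h3).
  by rewrite leq_add2r leqNgt hG.
rewrite inE => /andP[eF eG] eA; rewrite lt1 ?(subsetP sG) //.
by apply: h; rewrite ?(subsetP sG) // inE negb_or eA.
Qed.

End Minor.

Section HilbertFunction.
Variable n : nat.
Implicit Types (p q : {mpoly rat[n]}) (d k : nat).

Definition ideal_gen (X : finType) (g : X -> {mpoly rat[n]}) p : Prop :=
  exists c : X -> {mpoly rat[n]}, p = \sum_x c x * g x.

(* The classes of b form a basis of the degree d part of {mpoly rat[n]} / I. *)
Definition graded_basis (I : {mpoly rat[n]} -> Prop) d k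
    (b : 'I_k -> {mpoly rat[n]}) : Prop :=
  [/\ forall i, b i \is d.-homog,
      forall c : 'I_k -> rat, I (\sum_i c i *: b i) -> forall i, c i = 0
    & forall p, p \is d.-homog ->
        exists c : 'I_k -> rat, I (p - \sum_i c i *: b i)].

Section Ideal.
Variables (X : finType) (g : X -> {mpoly rat[n]}).
Let I := ideal_gen g.

Lemma ideal_gen0 : I 0.
Proof. by exists (fun=> 0); rewrite big1 // => x _; rewrite mul0r. Qed.

Lemma ideal_genD p q : I p -> I q -> I (p + q).
Proof.
case=> c -> [c' ->]; exists (fun x => c x + c' x).
by rewrite -big_split; apply: eq_bigr => x _; rewrite mulrDl.
Qed.

Lemma ideal_genM p q : I q -> I (p * q).
Proof.
case=> c ->; exists (fun x => p * c x).
by rewrite mulr_sumr; apply: eq_bigr => x _; rewrite mulrA.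
Qed.

Lemma ideal_genZ (a : rat) p : I p -> I (a *: p).
Proof. by rewrite -mul_mpolyC; apply: ideal_genM. Qed.

Lemma ideal_genN p : I p -> I (- p).
Proof. by rewrite -scaleN1r; apply: ideal_genZ. Qed.

Lemma ideal_gen_sum (J : Type) (r : seq J) (P : pred J) F :
  (forall j, P j -> I (F j)) -> I (\sum_(j <- r | P j) F j).
Proof.
by move=> h; apply: big_rec => [|j p /h]; [apply: ideal_gen0 | apply: ideal_genD].
Qed.

Lemma ideal_gen_in x : I (g x).
Proof.
exists (fun y => (y == x)%:R); rewrite (bigD1 x) //= eqxx mul1r.
by rewrite big1 ?addr0 // => y /negPf->; rewrite mul0r.
Qed.

Lemma graded_basis_unique d k k' (b : 'I_k -> {mpoly rat[n]})
    (b' : 'I_k' -> {mpoly rat[n]}) :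
  graded_basis I d b -> graded_basis I d b' -> k = k'.
Proof.
wlog suff le : k k' b b' / graded_basis I d b -> graded_basis I d b' ->
    (k <= k')%N.
  by move=> h h'; apply/eqP; rewrite eqn_leq (le _ _ b b') // (le _ _ b' b).
move=> [hb fb _] [_ _ sb'].
have /choice[A hA] : forall i, exists c : 'I_k' -> rat,
    I (b i - \sum_j c j *: b' j) by move=> i; apply: sb'.
pose a := \matrix_(i, j) A i j.
suff : row_free a by rewrite /row_free => /eqP <-; apply: rank_leq_col.
rewrite -kermx_eq0; apply/eqP/row_matrixP => r; rewrite row0.
set u := row r _; have ua0 : u *m a = 0.
  by rewrite /u -row_mul mulmx_ker row0.
apply/rowP => i; rewrite [RHS]mxE; move: i; apply: fb.
have <- : \sum_i u 0 i *: (b i - \sum_j A i j *: b' j)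
          = \sum_i u 0 i *: b i.
  under eq_bigr do rewrite scalerBr scaler_sumr.
  rewrite sumrB exchange_big /= [X in _ - X]big1 ?subr0 // => j _.
  under eq_bigr do rewrite scalerA.
  rewrite -scaler_suml; have /rowP/(_ j) := ua0; rewrite [LHS]mxE [RHS]mxE => E.
  rewrite (_ : \sum_i _ = 0) ?scale0r // -[RHS]E.
  by apply: eq_bigr => i _; rewrite [a _ _]mxE.
by apply: ideal_gen_sum => i _; apply: ideal_genZ.
Qed.

Lemma graded_basis_exists d : exists k, exists b, @graded_basis I d k b.
Proof.
pose N := #|{: 'X_{1..n < d.+1}}|.
pose P k := `[< exists b : 'I_k -> {mpoly rat[n]},
  (forall i, b i \is d.-homog) /\
  forall c : 'I_k -> rat, I (\sum_i c i *: b i) -> forall i, c i = 0 >].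
have P0 : exists k, P k.
  exists 0%N; apply/asboolP; exists (fun=> 0); split=> [[]//|c _ []//].
have PN k : P k -> (k <= N)%N.
  case/asboolP=> b [hb fb].
  pose mon (j : 'I_N) : 'X_{1..n < d.+1} := enum_val j.
  pose a : 'M[rat]_(k, N) := \matrix_(i, j) (b i)@_(mon j).
  suff : row_free a by rewrite /row_free => /eqP <-; apply: rank_leq_col.
  rewrite -kermx_eq0; apply/eqP/row_matrixP => r; rewrite row0.
  set u := row r _; have ua0 : u *m a = 0.
    by rewrite /u -row_mul mulmx_ker row0.
  apply/rowP => i; rewrite [RHS]mxE; move: i; apply: fb.
  suff -> : \sum_i u 0 i *: b i = 0 by apply: ideal_gen0.
  apply/mpolyP => m; rewrite mcoeff0 raddf_sum /=.
  have [md|md] := eqVneq (mdeg m) d; last first.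
    rewrite big1 // => i _; rewrite mcoeffZ.
    by rewrite (dhomog_nemf_coeff (hb i)) ?mulr0.
  have md' : (mdeg m < d.+1)%N by rewrite md.
  pose j : 'I_N := enum_rank (BMultinom md').
  have /rowP/(_ j) := ua0; rewrite [LHS]mxE [RHS]mxE => E; rewrite -[RHS]E.
  by apply: eq_bigr => i _; rewrite mcoeffZ [a _ _]mxE /mon enum_rankK.
case: (ex_maxnP P0 PN) => k /asboolP[b [hb fb]] kmax; exists k, b; split=> //.
move=> p hp; apply: contrapT => nsp.
suff /kmax : P k.+1 by rewrite ltnn.
apply/asboolP; exists (fun i => oapp b p (unlift ord0 i)); split.
  by move=> i; case: unliftP => [j|] _ /=.
move=> c; rewrite big_ord_recl unlift_none /=.
under eq_bigr do rewrite liftK /=.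
move=> Ic; have [c0|c0] := eqVneq (c ord0) 0.
  move=> i; case: (unliftP ord0 i) => [j|] -> //.
  move: Ic; rewrite c0 scale0r add0r.
  by move=> /(fb (fun i => c (lift ord0 i))).
case: nsp; exists (fun i => - (c ord0)^-1 * c (lift ord0 i)).
have -> : p - \sum_i (- (c ord0)^-1 * c (lift ord0 i)) *: b i
   = (c ord0)^-1 *: (c ord0 *: p + \sum_i c (lift ord0 i) *: b i).
  rewrite scalerDr scalerA mulVf // scale1r; congr (_ + _).
  rewrite scaler_sumr -sumrN; apply: eq_bigr => i _.
  by rewrite scalerA -scaleNr mulNr opprK.
exact: ideal_genZ.
Qed.

(* The dimension of the degree d part of {mpoly rat[n]} / I. *)
Definition hilbert_fun d : nat := sval (cid (graded_basis_exists d)).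

Lemma hilbert_funP d : exists b, @graded_basis I d (hilbert_fun d) b.
Proof. exact: (svalP (cid (graded_basis_exists d))). Qed.

Lemma hilbert_fun_unique d k (b : 'I_k -> {mpoly rat[n]}) :
  graded_basis I d b -> hilbert_fun d = k.
Proof.
by move=> hb; have [b' hb'] := hilbert_funP d; apply: graded_basis_unique hb' hb.
Qed.

Lemma ideal_gen_nilD p q i j : I (p ^+ i) -> I (q ^+ j) -> I ((p + q) ^+ (i + j)).
Proof.
move=> Ip Iq; rewrite exprDn; apply: ideal_gen_sum => l _.
rewrite -mulr_natl; apply: ideal_genM; have [le|lt] := leqP j l.
  by rewrite -(subnK le) exprD mulrA; apply: ideal_genM.
have le : (i <= i + j - l)%N by rewrite -addnBA ?leq_addr // ltnW.
by rewrite -(subnK le) exprD mulrC mulrA; apply: ideal_genM.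
Qed.

Lemma hilbert_fun_eventually0 :
  (forall i : 'I_n, exists e, I ('X_i ^+ e)) ->
  exists p : {poly rat}, forall d, p`_d = (hilbert_fun d)%:R.
Proof.
move=> /choice[e he]; pose N := (\sum_i e i).+1%N.
exists (\poly_(d < N) (hilbert_fun d)%:R) => d; rewrite coef_poly.
case: ltnP => // led; suff -> : hilbert_fun d = 0%N by [].
apply: (@hilbert_fun_unique d 0 (fun=> 0)); split=> [[]//|c _ []//|p hp].
exists (fun=> 0); rewrite big_ord0 subr0 [p]mpolyE big_seq.
apply: ideal_gen_sum => m mp; apply: ideal_genZ.
have md : mdeg m = d by move/dhomogP: hp => /(_ _ mp).
have [i lei] : exists i, (e i <= m i)%N.
  apply: contrapT => ne; move: led; rewrite -md mdegE ltnNge => /negP; apply.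
  apply: leq_sum => i _; rewrite leqNgt; apply/negP => lt.
  by apply: ne; exists i; apply: ltnW.
rewrite mpolyXE_id (bigD1 i) //= -(subnK lei) exprD mulrC mulrA.
exact: ideal_genM.
Qed.

End Ideal.
End HilbertFunction.

Section ChowRing.
Variables (T : finType) (M : rankData T) (BB : {set {set T}}).

(* The variable 'X_i stands for x_B, with B = enum_val i the i-th member of   *)
(* BB; S is a subset of BB given by the indices of its members.               *)
Definition sup_below (S : {set 'I_#|BB|}) (B : {set T}) : {set T} :=
  cl M (\bigcup_(j in S | enum_val j \proper B) enum_val j).

Definition chow_gen (Si : {set 'I_#|BB|} * 'I_#|BB|) : {mpoly rat[#|BB|]} :=
  let B := enum_val Si.2 in
  (\prod_(j in Si.1) 'X_j) *
  (\sum_(k < #|BB| | B \subset enum_val k) 'X_k)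
    ^+ (rk M B - rk M (sup_below Si.1 B)).

(* The Chow ring is {mpoly rat[#|BB|]} modulo this ideal. *)
Definition chow_ideal : {mpoly rat[#|BB|]} -> Prop := ideal_gen chow_gen.

Lemma chow_var_nilpotent (i : 'I_#|BB|) : exists e, chow_ideal ('X_i ^+ e).
Proof.
pose v (i : 'I_#|BB|) : {set T} := enum_val i.
have [m] := ubnP #|~: v i|; elim: m i => // m IHm i; rewrite ltnS => lem.
have sumE : \sum_(k < #|BB| | v i \subset v k) 'X_k
   = 'X_i + \sum_(k < #|BB| | v i \proper v k) 'X_k :> {mpoly rat[#|BB|]}.
  rewrite (bigD1 i) //=; congr (_ + _); apply: eq_bigl => k.
  rewrite properEneq andbC; congr (_ && _).
  by rewrite (inj_eq enum_val_inj) eq_sym.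
have [e1 h1] : exists e, chow_ideal ((\sum_(k < #|BB| | v i \subset v k) 'X_k) ^+ e).
  exists (rk M (v i) - rk M (sup_below set0 (v i)))%N.
  suff <- : chow_gen (set0, i) = (\sum_(k < #|BB| | v i \subset v k) 'X_k)
      ^+ (rk M (v i) - rk M (sup_below set0 (v i))) by apply: ideal_gen_in.
  by rewrite /chow_gen /= big_set0 mul1r.
have [e2 h2] : exists e,
    chow_ideal ((- \sum_(k < #|BB| | v i \proper v k) 'X_k) ^+ e).
  rewrite -sumrN; elim/big_rec: _ => [|k q ltk [e he]].
    by exists 1%N; rewrite expr0n; apply: ideal_gen0.
  have [|e' he'] := IHm k.
    by apply: leq_trans lem; apply: proper_card; rewrite properC.
  exists (e' + e)%N; apply: ideal_gen_nilD => //.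
  by rewrite exprNn; apply: ideal_genM.
exists (e1 + e2)%N; rewrite -['X_i](addrK (\sum_(k < #|BB| | v i \proper v k) 'X_k)).
by rewrite -sumE; apply: ideal_gen_nilD.
Qed.

Lemma chow_hilbert_exists :
  exists p : {poly rat}, forall d, p`_d = (hilbert_fun chow_gen d)%:R.
Proof. exact/hilbert_fun_eventually0/chow_var_nilpotent. Qed.

(* The Chow ring is finite-dimensional, so its Hilbert series is a polynomial.*)
Definition chow_hilbert : {poly rat} := sval (cid chow_hilbert_exists).

Lemma coef_chow_hilbert d : chow_hilbert`_d = (hilbert_fun chow_gen d)%:R.
Proof. exact: (svalP (cid chow_hilbert_exists)). Qed.

End ChowRing.

Section IncidenceAlgebra.
Variables (T : finType) (M : rankData T).
Implicit Types (F G H : {set T}) (GG : {set {set T}}).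

Local Notation Qx := {fraction {poly rat}}.

Definition interval_of : finType :=
  {FG : {set T} * {set T} | [&& flat M FG.1, flat M FG.2 & FG.1 \subset FG.2]}.

Definition incidence : zmodType := {ffun interval_of -> Qx}.

Definition inc_fun (f : {set T} -> {set T} -> Qx) : incidence :=
  [ffun FG : interval_of => f (val FG).1 (val FG).2].

(* a_{FG}, extended by 0 to pairs which are not intervals of flats *)
Definition inc_coef (a : incidence) F G : Qx :=
  oapp (a : {ffun interval_of -> Qx}) 0 (insub (F, G)).

Definition inc_mul (a b : incidence) : incidence :=
  inc_fun (fun F G =>
    \sum_(H | [&& flat M H, F \subset H & H \subset G])
      inc_coef a F H * inc_coef b H G).

Definition inc_delta : incidence := inc_fun (fun F G => (F == G)%:R).

Definition inc_inverse (a b : incidence) : Prop :=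
  inc_mul a b = inc_delta /\ inc_mul b a = inc_delta.

Definition reduced_char GG : incidence :=
  inc_fun (fun F G =>
    if F == G then -1
    else - (tofrac (char_poly_pm (minor M F G))
            / tofrac (1 - 'X) ^+ #|maxels (minor_building M GG F G)|)).

Definition chow_fun GG : incidence :=
  inc_fun (fun F G =>
    if F == G then 1
    else tofrac (chow_hilbert (minor M F G) (minor_building M GG F G))).

End IncidenceAlgebra.

(* Main.v *)
Require Import Defs.
From HB Require Import structures.
From mathcomp Require Import all_boot all_algebra.
From mathcomp Require Import fraction boolp mpoly.
From mathcomp Require Import zify ring.

(* The Chow ring has the Feichtner-Yuzvinsky monomial basis: [m] is standard if
   [m_B < rk B - rk (sup (supp m, B))] for every [B] in the building set. The
   relations rewrite any other monomial in terms of larger flats, and linear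
   independence is shown by eliminating one variable [x_g], [g] minimal, at a
   time, as in the blow-up formula: modulo the other relations the ring is
   [A[x_g] / (x_g J, (x_g + c)^r)], and the point is that [c^r J = 0] in [A].

   Writing the Hilbert series of each lower interval as a sum over standard
   monomials and exchanging sums, [sum_H Hilb(0,H) chi(H,E) / (1-x)^k(H)]
   becomes a sum over standard monomials [m] of [x^|m|] times a product over
   the maximal members [G] of the building set of [(x^a - x) / (1 - x)], where
   [a] is the corank in [G] of the part of [m] below [G]; here one uses
   [sum_(H >= F) chi(H,G) = x^(rk G - rk F)]. For one fixed such [G0] the sum
   over the exponent of [x_G0] already vanishes. An arbitrary interval is
   reduced to a lower one by passing to the minor, whose induced building set
   again satisfies the axioms that are used. *)

Set Implicit Arguments.
Unset Strict Implicit.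
Unset Printing Implicit Defensive.

Import GRing.Theory.

Local Open Scope ring_scope.

(** The obstacle in the elimination is that the two families of relations in [x_g] interact: a
    combination of degree below [r] can have a constant term in [c^r J]. Once [c^r J] vanishes in
    [A], the quotient splits for [r > 0] into [A] and one copy of [A / J] for each [x_g^k] with
    [0 < k < r]. The positive powers see a smaller ring because a present [x_g] lowers the exponents
    of the relations above [g]; hence the induction runs over pairs of variables left and variables
    declared present. The vanishing itself comes from submodularity and from the fact that
    incomparable members with nonempty intersection have product zero.

    The isomorphism axiom is awkward to transport to minors, whereas additivity of rank is not and
    already forces a flat to be determined by its traces on the components. The isomorphisms
    therefore serve only to obtain closure under joins of meeting members and the generation of a
    flat by its components.

    A positive exponent of [x_G0] makes the corank in [G0] zero and its factor 1, so the last sum is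
    [(x^a - x)/(1 - x) + x + ... + x^(a-1) = 0]. *)

(** * Ideal membership, coefficientwise and for powers *)

Section PolynomialIdeals.
Variables (n : nat) (X : finType) (h : X -> {mpoly rat[n]}).
Implicit Types (p q a b d x : {mpoly rat[n]}) (P Q : {poly {mpoly rat[n]}}).
Local Notation I := (ideal_gen h).

Definition coef_ideal P : Prop := forall k, I P`_k.

Lemma coef_ideal0 : coef_ideal 0.
Proof. by move=> k; rewrite coef0; apply: ideal_gen0. Qed.

Lemma coef_idealD P Q : coef_ideal P -> coef_ideal Q -> coef_ideal (P + Q).
Proof. by move=> hP hQ k; rewrite coefD; apply: ideal_genD. Qed.

Lemma coef_idealM P Q : coef_ideal Q -> coef_ideal (P * Q).
Proof.
by move=> hQ k; rewrite coefM; apply: ideal_gen_sum => i _; apply: ideal_genM.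
Qed.

Lemma coef_idealC p : I p -> coef_ideal p%:P.
Proof. by move=> Ip k; rewrite coefC; case: eqP => // _; apply: ideal_gen0. Qed.

(** Downward induction on [k]: as [P] is monic of degree [s], the coefficient of [Q * P] at [k + s]
    is that of [Q] at [k] plus multiples of coefficients of [Q] of higher index. *)
Lemma coef_ideal_quotient P Q s : P \is monic -> size P = s.+1 ->
  (forall k, (s <= k)%N -> I (Q * P)`_k) -> coef_ideal Q.
Proof.
move=> monP sizeP hQP k; have [w] := ubnP (size Q - k).
elim: w k => // w IHw k lew; have [le|lt] := leqP (size Q) k.
  by rewrite nth_default //; apply: ideal_gen0.
have := hQP (k + s)%N (leq_addl _ _); rewrite coefM.
have kks : (k < (k + s).+1)%N by rewrite ltnS leq_addr.
rewrite (bigD1 (Ordinal kks)) //= addKn.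
have -> : P`_s = 1 by move/monicP: monP; rewrite lead_coefE sizeP.
rewrite mulr1 => Iq; rewrite -[Q`_k](addrK (\sum_(i < (k + s).+1 | i != Ordinal kks)
  Q`_i * P`_(k + s - i))).
apply: ideal_genD => //; apply/ideal_genN/ideal_gen_sum => i.
rewrite -val_eqE /= => neq; have [ltik|leki] := ltnP i k.
  rewrite [P`__]nth_default ?mulr0 ?sizeP; first exact: ideal_gen0.
  clear -ltik; lia.
rewrite mulrC; apply/ideal_genM/IHw; clear -neq leki lew lt; lia.
Qed.

Lemma ideal_gen_pow p q i j : (i <= j)%N -> I (p * q ^+ i) -> I (p * q ^+ j).
Proof. by move=> /subnK <- Ip; rewrite exprD mulrCA; apply: ideal_genM. Qed.

(** The factor [x] annihilates [d], so next to it the base of a power may be changed by [d]. This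
    serves to exchange sums of variables over different upper sets. *)
Lemma ideal_gen_powD x q a d j :
  I (x * d) -> I (x * q * a ^+ j) -> I (x * q * (a + d) ^+ j).
Proof.
move=> Id Ia; rewrite -[(a + d) ^+ j](subrK (a ^+ j)) mulrDr.
apply: ideal_genD => //; rewrite subrXX addrAC subrr add0r.
set z := \sum_(_ < _) _.
have -> : x * q * (d * z) = q * z * (x * d) by ring.
exact: ideal_genM.
Qed.

End PolynomialIdeals.

(** * Polynomials as univariate polynomials in one variable *)

Section UnivariateView.
Variables (n : nat) (g : 'I_n).
Implicit Types (m : 'X_{1..n}) (p f : {mpoly rat[n]}).

(** The coefficients stay in [{mpoly rat[n]}] although they no longer involve ['X_g], so the type
    does not change along the elimination. *)
Definition uni : {mpoly rat[n]} -> {poly {mpoly rat[n]}} :=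
  mmap (polyC \o @mpolyC n rat) (fun i => if i == g then 'X else ('X_i)%:P).

HB.instance Definition _ := GRing.RMorphism.on uni.

Definition mdrop m : 'X_{1..n} := [multinom (if i == g then 0 else m i)%N | i < n].

Lemma uniX i : uni 'X_i = if i == g then 'X else ('X_i)%:P.
Proof. by rewrite /uni mmapX mmap1U. Qed.

Lemma uni_monom m : uni 'X_[m] = ('X_[mdrop m])%:P * 'X^(m g).
Proof.
rewrite /uni mmapX /mmap1 mpolyXE_id (bigD1 g) //= [in RHS](bigD1 g) //= eqxx.
rewrite mnmE eqxx expr0 mul1r mulrC; congr (_ * _).
rewrite rmorph_prod /=; apply: eq_bigr => i ig.
by rewrite mnmE (negPf ig) rmorphXn.
Qed.

Lemma uniE f :
  uni f = \sum_(m <- msupp f) (f@_m *: 'X_[mdrop m])%:P * 'X^(m g).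
Proof.
rewrite {1}[f]mpolyE rmorph_sum /=; apply: eq_bigr => m _.
rewrite -!mul_mpolyC rmorphM /= uni_monom polyCM mulrA; congr (_ * _ * _).
by rewrite /uni mmapC.
Qed.

Lemma coef_uni f k :
  (uni f)`_k = \sum_(m <- msupp f | m g == k) f@_m *: 'X_[mdrop m].
Proof.
rewrite uniE coef_sum big_mkcond [RHS]big_mkcond /=; apply: eq_bigr => m _.
by rewrite coefCM coefXn eq_sym; case: eqP; rewrite ?mulr1 ?mulr0.
Qed.

Lemma uniK f : (uni f).['X_g] = f.
Proof.
rewrite uniE horner_sum [RHS]mpolyE; apply: eq_bigr => m _.
rewrite hornerCM hornerXn -scalerAl; congr (_ *: _).
rewrite ['X_[mdrop m]]mpolyXE_id ['X_[m]]mpolyXE_id (bigD1 g) //= [in RHS](bigD1 g) //=.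
rewrite mnmE eqxx expr0 mul1r.
rewrite mulrC; congr (_ * _); apply: eq_bigr => i /negPf ig.
by rewrite mnmE ig.
Qed.

Lemma msupp_coef_uni f k m : m \in msupp (uni f)`_k ->
  exists2 m', m' \in msupp f & m' g = k /\ m = mdrop m'.
Proof.
rewrite coef_uni => /msupp_sum_le /flattenP[/= ms /mapP[m']].
rewrite mem_filter => /andP[/eqP <- m'f] -> /msuppZ_le; rewrite msuppX inE.
by move=> /eqP ->; exists m'.
Qed.

End UnivariateView.

(** * Relations and standard monomials *)

Section StandardMonomials.
Variables (T : finType) (E : {set T}) (r : {set T} -> nat).
Variables (n : nat) (v : 'I_n -> {set T}).
Hypothesis r_mono : forall A B : {set T},
  A \subset B -> B \subset E -> (r A <= r B)%N.
Hypothesis r_submod : forall A B : {set T}, A \subset E -> B \subset E ->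
  (r (A :|: B) + r (A :&: B) <= r A + r B)%N.
Hypothesis v_sub : forall i, v i \subset E.
Hypothesis v_inj : injective v.
Hypothesis v_neq0 : forall i, v i != set0.
Hypothesis v_join : forall i j, v i :&: v j != set0 ->
  exists k, [/\ v i :|: v j \subset v k, r (v k) = r (v i :|: v j)
    & forall l, v i :|: v j \subset v l -> v k \subset v l].

Implicit Types (S K D : {set 'I_n}) (B : {set T}) (i j k g : 'I_n).
Implicit Types (m : 'X_{1..n}) (p q f : {mpoly rat[n]}).

(** A union where the Chow ring has a join: both have the same rank, and no closure operator is
    needed here. *)
Definition under S B : {set T} := \bigcup_(j in S | v j \proper B) v j.

Definition codegree S i : nat := (r (v i) - r (under S (v i)))%N.

Definition above_sum K B : {mpoly rat[n]} := \sum_(k in K | B \subset v k) 'X_k.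

(* The relations among the variables of [K], the members of [D] being declared
   present in every monomial: this is the system met when the variables outside
   [K] are eliminated. *)
Definition std_gen K D (x : {set 'I_n} * 'I_n) : {mpoly rat[n]} :=
  if (x.1 \subset K) && (x.2 \in K)
  then (\prod_(j in x.1) 'X_j) * above_sum K (v x.2) ^+ codegree (x.1 :|: D) x.2
  else 0.

Definition supp m : {set 'I_n} := [set i | m i != 0%N].

Definition standard K D m : bool :=
  (supp m \subset K) && [forall i in K, (m i < codegree (supp m :|: D) i)%N].

(** Removing minimal members preserves this property, and it keeps the joins given by [v_join]
    inside [K]. *)
Definition upset K : Prop := forall i j, i \in K -> v i \subset v j -> j \in K.

Local Notation I K D := (ideal_gen (std_gen K D)).

Lemma under_sub S B : under S B \subset B.
Proof. by apply/bigcupsP => j /andP[_ /proper_sub]. Qed.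

Lemma under_subE S i : under S (v i) \subset E.
Proof. exact: subset_trans (under_sub _ _) (v_sub i). Qed.

Lemma sub_under S j B : j \in S -> v j \proper B -> v j \subset under S B.
Proof. by move=> jS lt; apply: (bigcup_max j) => //; rewrite jS. Qed.

Lemma underS S S' B B' : S \subset S' -> B \subset B' ->
  under S B \subset under S' B'.
Proof.
move=> sS sB; apply/bigcupsP => j /andP[jS lt].
by apply: sub_under; [apply: (subsetP sS) | apply: proper_sub_trans sB].
Qed.

Lemma eq_under S S' B :
    (forall j, v j \proper B -> (j \in S) = (j \in S')) ->
  under S B = under S' B.
Proof.
move=> h; apply: eq_bigl => j.
by case: (boolP (v j \proper B)) => [/h ->|]; rewrite ?andbF.
Qed.

Lemma std_gen_in K D S i a : S \subset K -> i \in K ->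
    (codegree (S :|: D) i <= a)%N ->
  I K D (\prod_(j in S) 'X_j * above_sum K (v i) ^+ a).
Proof.
move=> SK iK le; apply: ideal_gen_pow le _.
by have := ideal_gen_in (std_gen K D) (S, i); rewrite /std_gen /= SK iK.
Qed.

Lemma codegree_le S i (A : {set T}) :
  A \subset under S (v i) -> (codegree S i <= r (v i) - r A)%N.
Proof. by move=> sA; apply/leq_sub2l/r_mono => //; apply: under_subE. Qed.

(* Two members of [K] that meet properly have a join in [K], over which the
   relation has exponent 0. *)
Lemma incomparable_mul K D i j : upset K -> i \in K -> j \in K ->
    v i :&: v j != set0 -> ~~ (v i \subset v j) -> ~~ (v j \subset v i) ->
  I K D ('X_i * 'X_j).
Proof.
move=> uK iK jK ij0 nij nji; have [k [sk rk_k _]] := v_join ij0.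
have [ik jk] : v i \subset v k /\ v j \subset v k.
  by move: sk; rewrite subUset => /andP[].
have kK : k \in K := uK _ _ iK ik.
have neq : i != j by apply: contraNneq nij => ->.
have pik : v i \proper v k.
  by rewrite properE ik; apply: contra nji; apply: subset_trans.
have pjk : v j \proper v k.
  by rewrite properE jk; apply: contra nij; apply: subset_trans.
have := @std_gen_in K D [set i; j] k 0; rewrite expr0 mulr1 big_setU1 ?inE //=.
rewrite big_set1; apply=> //; first by rewrite subUset !sub1set iK.
rewrite (leq_trans (@codegree_le _ _ (v i :|: v j) _)) ?rk_k ?subnn //.
by rewrite subUset !sub_under // !inE eqxx ?orbT.
Qed.

(** * Elimination of a minimal variable *)

Section Elimination.
Variables (K D : {set 'I_n}) (g : 'I_n).
Hypotheses (uK : upset K) (gK : g \in K).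
Hypothesis g_min : forall i, i \in K -> ~~ (v i \proper v g).

Let K0 := K :\ g.
Let c := above_sum K0 (v g).
Let e := codegree D g.

Lemma upset_elim : upset K0.
Proof.
move=> i j; rewrite !inE => /andP[ig iK] sij; rewrite (uK iK sij) andbT.
apply: contraNneq (g_min iK) => jg; move: sij; rewrite jg => sig.
by rewrite properEneq sig (inj_eq v_inj) ig.
Qed.

Lemma codegree_min S : S \subset K -> codegree (S :|: D) g = e.
Proof.
move=> SK; congr (_ - r _)%N; apply: eq_under => j lt; rewrite inE.
by case: (boolP (j \in S)) => // /(subsetP SK) /g_min; rewrite lt.
Qed.

(** Here ['X_k] takes over the role of the eliminated ['X_g]. If [v k] lies inside [v i], then
    adding [k] to [S] lowers the exponent at least as far as [g] did, since [v g \subset v k].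
    Otherwise [v k] and [v i] are incomparable and both contain [v g], and the relation at their
    join [v l] is used. *)
Lemma elim_mul_var S i k : S \subset K0 -> i \in K0 -> v g \proper v i ->
    k \in K0 -> v g \subset v k -> ~~ (v i \subset v k) ->
  I K0 D ('X_k * (\prod_(j in S) 'X_j *
    above_sum K0 (v i) ^+ codegree (S :|: (g |: D)) i)).
Proof.
move=> SK iK gi kK gk nik; set a := codegree _ _.
have uK0 := upset_elim.
set U := under (S :|: (g |: D)) (v i).
have gU : v g \subset U by apply: sub_under => //; rewrite !inE eqxx orbT.
pose U' := under (S :|: D) (v i).
have UE : U \subset U' :|: v g.
  apply/bigcupsP => j /andP[]; rewrite !inE orbCA => /orP[/eqP->|jS] lt.
    exact: subsetUr.
  by apply: subset_trans (subsetUl _ _); apply: sub_under; rewrite ?inE.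
have kSP q : I K0 D (\prod_(j in k |: S) 'X_j * q) ->
    I K0 D ('X_k * (\prod_(j in S) 'X_j * q)).
  have [kS|kS] := boolP (k \in S); last by rewrite big_setU1 //= mulrA.
  by rewrite (setUidPr _) ?sub1set // => /ideal_genM.
have skS : k |: S \subset K0 by rewrite subUset sub1set kK.
have [ki|nki] := boolP (v k \subset v i).
  apply: kSP; apply: std_gen_in => //; apply: codegree_le.
  apply: subset_trans UE _; rewrite subUset; apply/andP; split.
    by apply: underS => //; rewrite -setUA subsetUr.
  apply: subset_trans gk _; apply: sub_under; first by rewrite !inE eqxx.
  by rewrite properE ki.
have ik0 : v k :&: v i != set0.
  apply: contraNneq (v_neq0 g) => ki0; rewrite -subset0 -ki0.
  by rewrite subsetI gk proper_sub.
have [l [sl rl lmin]] := v_join ik0.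
have [kl il] : v k \subset v l /\ v i \subset v l.
  by move: sl; rewrite subUset => /andP[].
have lK : l \in K0 := uK0 _ _ iK il.
have pil : v i \proper v l.
  by rewrite properE il; apply: contra nki; apply: subset_trans.
have pkl : v k \proper v l.
  by rewrite properE kl; apply: contra nik; apply: subset_trans.
(* Next to ['X_k] the sum over [v i] may be cut down to the sum over [v l]: every variable lost is
   incomparable to [k] and meets it in at least [v g]. *)
have step b q : I K0 D ('X_k * (q * above_sum K0 (v l) ^+ b)) ->
    I K0 D ('X_k * (q * above_sum K0 (v i) ^+ b)).
  have -> : above_sum K0 (v i)
      = above_sum K0 (v l)
        + \sum_(j in K0 | (v i \subset v j) && ~~ (v l \subset v j)) 'X_j.
    rewrite /above_sum (bigID (fun j => v l \subset v j)) /=; congr (_ + _).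
      apply: eq_bigl => j; rewrite -andbA; congr (_ && _).
      by apply/andP/idP => [[]|h'] //; split=> //; apply: subset_trans h'.
    by apply: eq_bigl => j; rewrite andbA.
  rewrite !mulrA; apply: ideal_gen_powD; rewrite mulr_sumr.
  apply: ideal_gen_sum => j /and3P[jK ij nlj]; apply: incomparable_mul => //.
  - apply: contraNneq (v_neq0 g) => kj0; rewrite -subset0 -kj0 subsetI gk.
    exact: subset_trans (proper_sub gi) ij.
  - by apply: contra nlj => kj; apply: lmin; rewrite subUset kj.
  - by apply: contra nik; apply: subset_trans.
apply/step/kSP/std_gen_in => //.
pose W := under ((k |: S) :|: D) (v l).
have kW : v k \subset W by apply: sub_under; rewrite // !inE eqxx.
have WE : W \subset E by apply: under_subE.
have UW : U \subset W :&: v i.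
  rewrite subsetI under_sub andbT; apply: subset_trans UE _.
  rewrite subUset (subset_trans gk kW) andbT; apply: underS => //.
  by rewrite -setUA subsetUr.
(* Submodularity for [W] and [v i]: the rank grows from [v i] to [v l] by no more than from
   [W :&: v i] to [W], so the exponent at [v l] is at most [a]. *)
rewrite /codegree leq_subLR -/W rl.
have WiE : W :|: v i \subset E by rewrite subUset WE v_sub.
have h1 : (r (v k :|: v i) <= r (W :|: v i))%N by apply: r_mono => //; apply: setSU.
have h2 := r_submod WE (v_sub i).
have h3 : (r U <= r (W :&: v i))%N.
  by apply: r_mono => //; apply: subset_trans WE; apply: subsetIl.
have h4 : (r U <= r (v i))%N by apply: r_mono => //; apply: under_sub.
rewrite /a /codegree -/U; clear -h1 h2 h3 h4; lia.
Qed.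

(** For a relation at some [v i] above [v g], [elim_mul_var] kills the variables of [c] that are not
    above [v i], so [c] may be replaced by [above_sum K0 (v i)]. The exponent becomes [a + e], which
    suffices because, by submodularity, declaring [g] present raises the rank of the part below
    [v i] by at most [e]. *)
Lemma elim_ideal p : I K0 (g |: D) p -> I K0 D (c ^+ e * p).
Proof.
case=> co ->; rewrite mulr_sumr; apply: ideal_gen_sum => -[S i] _.
rewrite mulrCA; apply: ideal_genM; rewrite /std_gen /=.
case: ifP => [/andP[SK iK]|_]; last by rewrite mulr0; apply: ideal_gen0.
have [gi|ngi] := boolP (v g \proper v i); last first.
  apply/ideal_genM/std_gen_in => //; rewrite /codegree.
  rewrite (@eq_under (S :|: (g |: D)) (S :|: D)) // => j lt; rewrite !inE.
  by case: eqP => // jg; rewrite -jg lt in ngi.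
set a := codegree _ _; set y := (X in _ * X).
have cE : c = above_sum K0 (v i)
    + \sum_(k in K0 | (v g \subset v k) && ~~ (v i \subset v k)) 'X_k.
  rewrite /c /above_sum (bigID (fun j => v i \subset v j)) /=; congr (_ + _).
    apply: eq_bigl => j; rewrite -andbA; congr (_ && _).
    apply/andP/idP => [[]|h'] //; split=> //.
    exact: subset_trans (proper_sub gi) h'.
  by apply: eq_bigl => j; rewrite andbA.
rewrite mulrC -[y]mulr1 cE; apply: ideal_gen_powD.
  rewrite mulr_sumr; apply: ideal_gen_sum => k /and3P[kK gk ik].
  by rewrite mulrC; apply: elim_mul_var.
rewrite mulr1 /y -mulrA -exprD; apply: std_gen_in => //; rewrite /a /e /codegree.
set U := under (S :|: D) (v i); set U1 := under (S :|: (g |: D)) _.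
set U0 := under D (v g).
have gE := v_sub g; have iE := v_sub i.
have U1E : U1 \subset E by apply: under_subE.
have UE : U \subset E by apply: under_subE.
have s1 : U1 \subset U :|: v g.
  apply/bigcupsP => j /andP[]; rewrite !inE orbCA => /orP[/eqP->|jS] lt.
    exact: subsetUr.
  by apply: subset_trans (subsetUl _ _); apply: sub_under; rewrite ?inE.
have h1 : (r U1 <= r (U :|: v g))%N by apply: r_mono; rewrite // subUset UE.
have h2 := r_submod UE gE.
have h3 : (r U0 <= r (U :&: v g))%N.
  apply: r_mono; last by apply: subset_trans UE; apply: subsetIl.
  rewrite subsetI under_sub andbT; apply: underS; last exact: proper_sub.
  exact: subsetUr.
have h4 : (r U1 <= r (v i))%N by apply: r_mono => //; apply: under_sub.
have h5 : (r U0 <= r (v g))%N by apply: r_mono => //; apply: under_sub.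
clear -h1 h2 h3 h4 h5; lia.
Qed.

Lemma elim_sub p : I K0 D p -> I K0 (g |: D) p.
Proof.
case=> co ->; apply: ideal_gen_sum => -[S i] _; apply: ideal_genM.
rewrite /std_gen /=; case: ifP => [/andP[SK iK]|_]; last exact: ideal_gen0.
apply: std_gen_in => //; apply: codegree_le; apply: underS => //.
by apply: setUS; apply: subsetUr.
Qed.

Lemma uni_above_sum B : uni g (above_sum K0 B) = (above_sum K0 B)%:P.
Proof.
rewrite /above_sum !rmorph_sum /=; apply: eq_bigr => k.
by rewrite !inE uniX => /andP[/andP[/negPf-> _] _].
Qed.

Lemma uni_prod S : S \subset K0 ->
  uni g (\prod_(j in S) 'X_j) = (\prod_(j in S) 'X_j)%:P.
Proof.
move=> SK; rewrite !rmorph_prod /=; apply: eq_bigr => k /(subsetP SK).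
by rewrite !inE uniX => /andP[/negPf-> _].
Qed.

Lemma above_sum_min : above_sum K (v g) = 'X_g + c.
Proof.
rewrite /above_sum (bigD1 g) ?gK //=; congr (_ + _); apply: eq_bigl => k.
by rewrite !inE andbC andbA.
Qed.

Lemma above_sum_elim i : i \in K0 -> above_sum K (v i) = above_sum K0 (v i).
Proof.
rewrite !inE => /andP[ig iK]; apply: eq_bigl => k; rewrite !inE.
case: eqP => //= ->; rewrite gK /=; apply/negP => sig.
by have := g_min iK; rewrite properEneq sig (inj_eq v_inj) ig.
Qed.

(** The relations fall into three kinds: those at [g] are multiples of the power of ['X + c%:P],
    always with exponent [e] by minimality; those with [g] in the product are ['X] times a relation
    in which [g] is declared present; the others are free of ['X]. *)
Lemma elim_decomp f : I K D f ->
  exists (Q J Y : {poly {mpoly rat[n]}}),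
    [/\ uni g f = Q * ('X + c%:P) ^+ e + 'X * J + Y,
    coef_ideal (std_gen K0 (g |: D)) J & coef_ideal (std_gen K0 D) Y].
Proof.
pose dec (F : {poly {mpoly rat[n]}}) :=
  exists (Q J Y : {poly {mpoly rat[n]}}),
    [/\ F = Q * ('X + c%:P) ^+ e + 'X * J + Y,
    coef_ideal (std_gen K0 (g |: D)) J & coef_ideal (std_gen K0 D) Y].
have dec0 : dec 0.
  by exists 0, 0, 0; rewrite mul0r mulr0 !addr0; split=> //; apply: coef_ideal0.
have decD F F' : dec F -> dec F' -> dec (F + F').
  move=> [q [j [y [-> hj hy]]]] [q' [j' [y' [-> hj' hy']]]].
  exists (q + q'), (j + j'), (y + y'); split; [ring | exact: coef_idealD..].
have decM F F' : dec F' -> dec (F * F').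
  move=> [q [j [y [-> hj hy]]]]; exists (F * q), (F * j), (F * y).
  split; [ring | exact: coef_idealM..].
case=> co ->; rewrite -/(dec _) rmorph_sum /=; elim/big_rec: _ => // -[S i] F _.
apply: decD; rewrite rmorphM; apply: (decM _ _); rewrite /std_gen /=.
case: ifP => [/andP[SK iK]|_]; last by rewrite rmorph0.
rewrite rmorphM rmorphXn /=; have [ig|ig] := eqVneq i g.
  apply: decM; rewrite ig above_sum_min rmorphD /= uniX eqxx uni_above_sum.
  rewrite codegree_min //; exists 1, 0, 0; rewrite mul1r mulr0 !addr0.
  by split=> //; apply: coef_ideal0.
have iK0 : i \in K0 by rewrite !inE ig.
rewrite above_sum_elim // uni_above_sum -rmorphXn.
have [gS|gS] := boolP (g \in S); last first.
  have SK0 : S \subset K0.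
    apply/subsetP => j jS; rewrite !inE (subsetP SK) // andbT.
    by apply: contraNneq gS => <-.
  rewrite uni_prod // -polyCM; exists 0, 0; eexists; split.
  - by rewrite mul0r mulr0 !add0r.
  - exact: coef_ideal0.
  - by apply: coef_idealC; apply: std_gen_in.
have SK0 : S :\ g \subset K0 by apply: setSD.
rewrite (big_setD1 g) //= rmorphM /= uniX eqxx uni_prod // -mulrA -polyCM.
exists 0; eexists; exists 0; split.
- by rewrite mul0r add0r addr0.
- apply: coef_idealC; apply: std_gen_in => //.
  by rewrite setUCA setUA setD1K.
- exact: coef_ideal0.
Qed.

(** The degree of [uni g f] is below that of the monic power, so the coefficients of the quotient
    [q] lie in the larger ideal. The constant term of the product is then [c ^+ e] times such a
    coefficient, and [elim_ideal] brings it into the smaller ideal. *)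
Lemma elim_coef f : (size (uni g f) <= e)%N -> I K D f ->
  I K0 D (uni g f)`_0 /\ coef_ideal (std_gen K0 (g |: D)) (uni g f).
Proof.
move=> sizef /elim_decomp [q [j [y [E1 hj hy]]]].
set P := ('X + c%:P) ^+ e in E1.
have hJ : coef_ideal (std_gen K0 (g |: D)) ('X * j + y).
  by apply: coef_idealD; [apply: coef_idealM | move=> k; apply: elim_sub].
have monP : P \is monic by apply: monic_exp; apply: monicXaddC.
have sizeP : size P = e.+1 by rewrite /P -[c%:P]opprK -polyCN size_exp_XsubC.
have hq : coef_ideal (std_gen K0 (g |: D)) q.
  apply: (coef_ideal_quotient monP sizeP) => k lek.
  have -> : (q * P)`_k = - ('X * j + y)`_k.
    apply/eqP; rewrite -addr_eq0 -coefD addrA -E1 nth_default //.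
    exact: leq_trans lek.
  exact: ideal_genN.
split; last first.
  by rewrite E1 -addrA; apply: coef_idealD => //; rewrite mulrC; apply: coef_idealM.
rewrite E1 !coefD coefXM /= addr0; apply: ideal_genD; last exact: hy.
rewrite coef0M mulrC.
have -> : P`_0 = c ^+ e by rewrite -horner_coef0 /P !hornerE.
exact: elim_ideal.
Qed.

End Elimination.

(** * Linear independence of the standard monomials *)

Lemma upset_min K : K != set0 ->
  exists2 g, g \in K & forall i, i \in K -> ~~ (v i \proper v g).
Proof.
case/set0Pn => k kK; case: (arg_minnP (fun i => #|v i|) kK) => g gK gmin.
exists g => // i /gmin le; apply/negP => /proper_card.
by rewrite ltnNge le.
Qed.

(** Without ['X_g], a standard monomial stays standard for the same [D]. With it, dropping ['X_g]
    takes [g] out of the support and [g |: D] puts it back. So the two conclusions of [elim_coef]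
    match two instances of the induction hypothesis. *)
Lemma standard_free K D f : upset K ->
  (forall m, m \in msupp f -> standard K D m) -> I K D f -> f = 0.
Proof.
have [w] := ubnP #|K|; elim: w K D f => // w IHw K D f lew uK stdf If.
have [K0|/upset_min [g gK gmin]] := eqVneq K set0.
  case: If => co ->; rewrite big1 // => x _.
  by rewrite /std_gen K0 inE andbF mulr0.
have uK' := upset_elim uK gmin.
have ltK : (#|K :\ g| < w)%N by move: lew; rewrite ltnS (cardsD1 g) gK.
have stdP m : m \in msupp f -> [/\ supp m \subset K, (m g < codegree D g)%N
    & forall i, i \in K -> (m i < codegree (supp m :|: D) i)%N].
  move/stdf => /andP[sm /forall_inP hm]; split=> //.
  by rewrite -(codegree_min D gmin sm); apply: hm.
have supp_drop m : supp (mdrop g m) = supp m :\ g.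
  by apply/setP => i; rewrite !inE mnmE; case: (i == g).
have sizef : (size (uni g f) <= codegree D g)%N.
  apply/leq_sizeP => k lek; rewrite coef_uni big_seq_cond big1 // => m.
  by case/andP => /stdP[_ lt _] /eqP mk; move: lt; rewrite mk ltnNge lek.
have [I0 Ik] := elim_coef uK gK gmin sizef If.
suff uf0 : uni g f = 0 by rewrite -(uniK g f) uf0 horner0.
apply/polyP => k; rewrite coef0.
have sub m : m \in msupp f -> supp (mdrop g m) \subset K :\ g.
  by move=> /stdP[sm _ _]; rewrite supp_drop setSD.
case: k => [|k].
  apply: (IHw (K :\ g) D) => // m /msupp_coef_uni [m' m'f [m'g ->]].
  rewrite /standard sub //=; apply/forall_inP => i iK.
  have [_ _ /(_ i)] := stdP _ m'f; move: iK; rewrite !inE mnmE.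
  move=> /andP[/negPf -> ->] /(_ isT); congr (_ < codegree _ _)%N.
  congr (_ :|: D); rewrite supp_drop; apply/setP => j; rewrite !inE.
  by case: (eqVneq j g) => // ->; rewrite m'g.
apply: (IHw (K :\ g) (g |: D)) => // m /msupp_coef_uni [m' m'f [m'g ->]].
rewrite /standard sub //=; apply/forall_inP => i iK.
have [_ _ /(_ i)] := stdP _ m'f; move: iK; rewrite !inE mnmE.
move=> /andP[/negPf -> ->] /(_ isT); congr (_ < codegree _ _)%N.
rewrite supp_drop; apply/setP => j; rewrite !inE.
by case: (eqVneq j g) => // ->; rewrite m'g.
Qed.

(** * Spanning by the standard monomials *)

Local Notation J := (I setT set0).

(** The termination measure: a reduction trades a variable for variables with larger sets, whose
    complements are smaller. *)
Definition weight m : nat := (\sum_i m i * #|~: v i|.+1)%N.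

Definition bounded d w p : Prop :=
  forall m, m \in msupp p -> mdeg m = d /\ (weight m <= w)%N.

Lemma weightD m m' : weight (m + m')%MM = (weight m + weight m')%N.
Proof.
by rewrite /weight -big_split; apply: eq_bigr => i _; rewrite mnmDE mulnDl.
Qed.

Lemma weight1 i : weight U_(i)%MM = #|~: v i|.+1.
Proof.
rewrite /weight (bigD1 i) //= mnm1E eqxx mul1n big1 ?addn0 // => j ji.
by rewrite mnm1E eq_sym (negPf ji).
Qed.

Lemma weightMn m (k : nat) : weight (m *+ k)%MM = (weight m * k)%N.
Proof.
elim: k => [|k IHk]; last by rewrite mulmS weightD IHk mulnS.
by rewrite mulm0n muln0 /weight big1 // => i _; rewrite mnm0E.
Qed.

Lemma boundedM d w d' w' p q : bounded d w p -> bounded d' w' q ->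
  bounded (d + d') (w + w') (p * q).
Proof.
move=> hp hq m /msuppM_le /allpairsP[[m1 m2] /= [/hp[<- h1] /hq[<- h2] ->]].
by rewrite mdegD weightD leq_add.
Qed.

Lemma bounded_sum d w (L : Type) (s : seq L) (P : pred L) F :
  (forall l, P l -> bounded d w (F l)) -> bounded d w (\sum_(l <- s | P l) F l).
Proof.
move=> hF; elim/big_rec: _ => [|l p Pl hp] m; first by rewrite msupp0.
by move=> /msuppD_le; rewrite mem_cat => /orP[/(hF _ Pl)|/hp].
Qed.

Lemma boundedX m : bounded (mdeg m) (weight m) 'X_[m].
Proof. by move=> m'; rewrite msuppX inE => /eqP->. Qed.

Lemma bounded_exp d w p (k : nat) : bounded d w p -> bounded (d * k) (w * k) (p ^+ k).
Proof.
move=> hp; elim: k => [|k IHk]; last by rewrite exprS !mulnS; apply: boundedM.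
rewrite !muln0 expr0 -mpolyX0 => m; rewrite msuppX inE => /eqP->.
by rewrite mdeg0 -(mulm0n 0%MM) weightMn muln0.
Qed.

Definition reducible d p : Prop := exists f,
  (forall m, m \in msupp f -> standard setT set0 m /\ mdeg m = d) /\ J (p - f).

Lemma reducibleD d p q : reducible d p -> reducible d q -> reducible d (p + q).
Proof.
move=> [f [hf If]] [f' [hf' If']]; exists (f + f'); split=> [m|].
  by move=> /msuppD_le; rewrite mem_cat => /orP[/hf|/hf'].
by rewrite opprD addrACA; apply: ideal_genD.
Qed.

Lemma reducible_ideal d p : J p -> reducible d p.
Proof. by move=> Jp; exists 0; split=> [m|]; rewrite ?msupp0 ?subr0. Qed.

Lemma reducible_sum d (L : Type) (s : seq L) (P : pred L) F :
  (forall l, P l -> reducible d (F l)) -> reducible d (\sum_(l <- s | P l) F l).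
Proof.
move=> hF; elim/big_rec: _ => [|l p Pl]; last exact/reducibleD/hF.
exact/reducible_ideal/ideal_gen0.
Qed.

Lemma reducibleZ d a p : reducible d p -> reducible d (a *: p).
Proof.
move=> [f [hf If]]; exists (a *: f); split=> [m /msuppZ_le /hf //|].
by rewrite -scalerBr; apply: ideal_genZ.
Qed.

(** If [m i] reaches the bound [a], the relation at [i] applies. Its base is [h = 'X_i + d] with [d]
    made of variables strictly above [v i], and [h ^+ a - 'X_i ^+ a] is divisible by [d], so modulo
    [J] the monomial becomes a combination of monomials of the same degree and smaller weight. *)
Lemma reducible_monom m : reducible (mdeg m) 'X_[m].
Proof.
have [w] := ubnP (weight m); elim: w m => // w IHw m lew.
have [stdm|] := boolP (standard setT set0 m).
  exists 'X_[m]; split=> [m'|]; first by rewrite msuppX inE => /eqP->.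
  by rewrite subrr; apply: ideal_gen0.
rewrite /standard subsetT /= negb_forall_in => /exists_inP[i _].
rewrite setU0 -leqNgt; set a := codegree _ _ => lea.
pose m1 : 'X_{1..n} := (m - U_(i) *+ a)%MM.
have mE : m = (m1 + U_(i) *+ a)%MM.
  rewrite submK //; apply/mnm_lepP => j; rewrite mulmnE mnm1E.
  by case: eqP => [<-|_]; rewrite ?mul1n.
(* No ['X_i] need be left in [m1], so the product runs over the other variables of [m]; the exponent
   is unaffected, since [v i] is not properly below itself. *)
pose S := supp m :\ i; pose m2 : 'X_{1..n} := (m1 - \sum_(j in S) U_(j))%MM.
have m1E : m1 = (m2 + \sum_(j in S) U_(j))%MM.
  rewrite submK //; apply/mnm_lepP => j; rewrite mnm_sumE.
  have [jS|jS] := boolP (j \in S); last first.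
    by rewrite big1 // => k kS; rewrite mnm1E; case: eqP => // kj; rewrite -kj kS in jS.
  rewrite (bigD1 j) //= big1 => [|k /andP[_ /negPf kj]]; last by rewrite mnm1E kj.
  rewrite mnm1E eqxx mnmBE mulmnE mnm1E; move: jS; rewrite !inE eq_sym.
  by move=> /andP[/negPf->]; rewrite mul0n subn0 addn0 lt0n.
set h := above_sum setT (v i).
have Ih : J ('X_[m1] * h ^+ a).
  rewrite m1E mpolyXD (big_morph _ (@mpolyXD n rat) (@mpolyX0 n rat)) -mulrA.
  apply/ideal_genM/std_gen_in; rewrite ?subsetT ?inE //.
  rewrite setU0 /codegree (@eq_under S (supp m)) // => j lt.
  by rewrite !inE; case: eqP lt => // ->; rewrite properxx.
pose d := \sum_(k | (v i \subset v k) && (k != i)) 'X_k : {mpoly rat[n]}.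
have hE : h = 'X_i + d.
  rewrite /h /above_sum (bigD1 i) ?inE //=.
  by congr (_ + _); apply: eq_bigl => k; rewrite inE.
pose z := \sum_(k < a) h ^+ (a.-1 - k) * 'X_i ^+ k.
have XmE : 'X_[m] = 'X_[m1] * h ^+ a - 'X_[m1] * d * z.
  have -> : d = h - 'X_i by rewrite hE addrC addKr.
  rewrite -mulrA -subrXX -mulrBr opprB addrCA subrr addr0.
  by rewrite {1}mE mpolyXD mpolyXn.
have bd : bounded 1 #|~: v i| d.
  apply: bounded_sum => k /andP[sik ki] m'; rewrite msuppX inE => /eqP->.
  rewrite mdeg1 weight1; split=> //; apply: proper_card.
  by rewrite properC properEneq sik (inj_eq v_inj) eq_sym ki.
have bi : bounded 1 #|~: v i|.+1 'X_i by rewrite -weight1 -(mdeg1 i); apply: boundedX.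
have bh : bounded 1 #|~: v i|.+1 h.
  rewrite hE => m' /msuppD_le; rewrite mem_cat => /orP[/bi//|/bd[-> le]].
  by split=> //; apply: ltnW.
have bz : bounded a.-1 (#|~: v i|.+1 * a.-1) z.
  apply: bounded_sum => k _; have ka : (k <= a.-1)%N
    by rewrite -ltnS (ltn_predK (ltn_ord k)).
  rewrite -{1}(subnK ka) -{2}(subnK ka) mulnDr.
  have := boundedM (bounded_exp (k := (a.-1 - k)%N) bh) (bounded_exp (k := k) bi).
  by rewrite !mul1n.
have redR : reducible (mdeg m) ('X_[m1] * d * z).
  (* For [a = 0] the monomial is itself in the ideal and [z] is an empty sum; the degree count with
     [a.-1] needs [a] positive. *)
  case: (posnP a) => [a0|apos].
    apply: reducible_ideal; rewrite /z a0 big_ord0 mulr0; exact: ideal_gen0.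
  rewrite [X in reducible _ X]mpolyE big_seq; apply: reducible_sum => m' hm'.
  apply: reducibleZ.
  have [] := boundedM (boundedM (boundedX (m := m1)) bd) bz hm' => dm' wm'.
  have -> : mdeg m = mdeg m'.
    by rewrite dm' mE mdegD mdegMn mdeg1 mul1n; clear -apos; lia.
  apply: IHw; apply: (@leq_trans (weight m)); last by rewrite -ltnS.
  rewrite mE weightD weightMn weight1; clear -apos wm'; nia.
rewrite XmE; apply: reducibleD; first exact: reducible_ideal.
by rewrite -scaleN1r; apply: reducibleZ.
Qed.

Lemma hilbert_fun_standard (X : finType) (h : X -> {mpoly rat[n]}) d :
    (forall p, ideal_gen h p <-> J p) ->
  hilbert_fun h d =
    #|[set m : 'X_{1..n < d.+1} | standard setT set0 m & mdeg m == d]|.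
Proof.
move=> hJ; set A := [set m | _ & _].
apply: (@hilbert_fun_unique _ _ _ _ _ (fun i : 'I_#|A| => 'X_[val (enum_val i)])).
have AP (i : 'I_#|A|) :
    standard setT set0 (val (enum_val i)) /\ mdeg (val (enum_val i)) = d.
  by have := enum_valP i; rewrite inE => /andP[? /eqP].
split=> [i|co /hJ Jc i|p hp].
- by apply/dhomogP => m; rewrite msuppX inE => /eqP->; have [] := AP i.
- have /mpolyP/(_ (val (enum_val i))) :
      \sum_i co i *: 'X_[val (enum_val i)] = 0 :> {mpoly rat[n]}.
    apply: standard_free Jc => [j k _ _|m]; first by rewrite inE.
    move=> /msupp_sum_le /flattenP[/= ms /mapP[j _ ->]].
    by move=> /msuppZ_le; rewrite msuppX inE => /eqP->; have [] := AP j.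
  rewrite mcoeff0 raddf_sum /= (bigD1 i) //= mcoeffZ mcoeffX eqxx mulr1.
  rewrite big1 ?addr0 // => j ji; rewrite mcoeffZ mcoeffX.
  by rewrite (inj_eq val_inj) (inj_eq enum_val_inj) (negPf ji) mulr0.
have [f [hf Jf]] : reducible d p.
  rewrite [p]mpolyE big_seq; apply: reducible_sum => m mp; apply: reducibleZ.
  by move/dhomogP: hp => /(_ _ mp) <-; apply: reducible_monom.
exists (fun l : 'I_#|A| => f@_(val (enum_val l))); apply/hJ.
suff -> : \sum_(i < #|A|) f@_(val (enum_val i)) *: 'X_[val (enum_val i)] = f by [].
apply/mpolyP => m; rewrite raddf_sum /=.
have [mf|mf] := boolP (m \in msupp f); last first.
  rewrite (memN_msupp_eq0 mf) big1 // => i _; rewrite mcoeffZ mcoeffX.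
  by case: eqP => [->|_]; rewrite ?mulr0 // (memN_msupp_eq0 mf) mul0r.
have [stdm md] := hf m mf; have mlt : (mdeg m < d.+1)%N by rewrite md.
have mA : BMultinom mlt \in A by rewrite inE stdm md eqxx.
rewrite (bigD1 (enum_rank_in mA (BMultinom mlt))) //= enum_rankK_in //=.
rewrite mcoeffZ mcoeffX eqxx mulr1 big1 ?addr0 // => j jm.
rewrite mcoeffZ mcoeffX; case: eqP => [E1|_]; rewrite ?mulr0 //.
case/eqP: jm; apply: enum_val_inj; rewrite enum_rankK_in //.
exact: val_inj.
Qed.

End StandardMonomials.

(** * Closure, rank and components of a building set *)

Section Closure.
Variables (T : finType) (M : rankData T).
Hypothesis pM : polymatroid M.
Implicit Types (A B F G H P : {set T}) (GG : {set {set T}}).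
Local Notation E := (gset M).
Local Notation rk := (rk M).
Local Notation cl := (cl M).

Lemma rk_mono A B : A \subset B -> B \subset E -> (rk A <= rk B)%N.
Proof. by case: pM => _ h _; apply: h. Qed.

Lemma rk_submod A B : A \subset E -> B \subset E ->
  (rk (A :|: B) + rk (A :&: B) <= rk A + rk B)%N.
Proof. by case: pM => _ _; apply. Qed.

Lemma flat_sub F : flat M F -> F \subset E.
Proof. by case/flatP. Qed.

Lemma cl_sub A : A \subset E -> cl A \subset E.
Proof. by apply: cl_min; apply: flat_gset. Qed.

Lemma clS A B : A \subset B -> B \subset E -> cl A \subset cl B.
Proof.
move=> sAB sB; apply: cl_min; first exact: flat_cl.
exact: subset_trans (sub_cl _ _).
Qed.

Lemma cl_flat F : flat M F -> cl F = F.
Proof. by move=> fF; apply/eqP; rewrite eqEsubset sub_cl cl_min. Qed.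

Lemma cl_subE A F : flat M F -> (cl A \subset F) = (A \subset F).
Proof.
move=> fF; apply/idP/idP; last exact: cl_min.
exact: subset_trans (sub_cl _ _).
Qed.

(** A largest set above [A] of the same rank is a flat, as any further element raises the rank; so
    it contains [cl A]. *)
Lemma rk_cl A : A \subset E -> rk (cl A) = rk A.
Proof.
move=> sA; pose Q B := [&& A \subset B, B \subset E & rk B == rk A].
have QA : Q A by rewrite /Q subxx sA eqxx.
case: (arg_maxnP (fun B : {set T} => #|B|) QA) => B /and3P[sAB sB /eqP rB] Bmax.
have fB : flat M B.
  apply/flatP; split=> // x xE xB.
  have sxB : x |: B \subset E by rewrite subUset sub1set xE.
  rewrite ltn_neqAle rk_mono ?subsetUr // andbT; apply/eqP => rxB.
  have /Bmax : Q (x |: B) by rewrite /Q sxB -rxB rB eqxx (subset_trans sAB) ?subsetUr.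
  by rewrite /= cardsU1 xB add1n => /(leq_trans (ltnSn _)); rewrite ltnn.
apply/eqP; rewrite eqn_leq -{1}rB !rk_mono ?sub_cl ?cl_sub //.
by rewrite cl_min.
Qed.

Lemma flat_rk_eq F A : flat M F -> F \subset A -> A \subset E ->
  (rk A <= rk F)%N -> A = F.
Proof.
move=> /flatP[sF hF] sFA sA le; apply/eqP; rewrite eqEsubset sFA andbT.
apply/subsetP => x xA; apply: contraLR le => xF; rewrite -ltnNge.
apply: (leq_trans (hF x _ xF)); first exact: (subsetP sA).
by apply: rk_mono => //; rewrite subUset sub1set xA.
Qed.

Lemma maxels_sub GG : maxels GG \subset GG.
Proof. by apply/subsetP => G; rewrite inE => /andP[]. Qed.

Lemma maxels_above GG B : B \in GG -> exists2 G, G \in maxels GG & B \subset G.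
Proof.
move=> BG; pose Q C := (C \in GG) && (B \subset C).
have QB : Q B by rewrite /Q BG subxx.
case: (arg_maxnP (fun C : {set T} => #|C|) QB) => C /andP[CG sBC] Cmax.
exists C => //; rewrite inE CG; apply/existsP => -[D /andP[DG ltCD]].
have /Cmax : Q D by rewrite /Q DG (subset_trans sBC) ?proper_sub.
by rewrite /= leqNgt proper_card.
Qed.

Lemma maxels_antichain GG G H : G \in maxels GG -> H \in maxels GG ->
  G \subset H -> G = H.
Proof.
rewrite !inE => /andP[_ nG] /andP[HG _] sGH; apply/eqP; apply: contraNT nG => neq.
by apply/existsP; exists H; rewrite HG properEneq neq.
Qed.

(* What remains of a building set once the lattice isomorphisms are replaced
   by the rank condition, which implies them. *)
Definition wbuilding GG : Prop :=
  [/\ forall G, G \in GG -> flat M G /\ G != set0,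
      forall G H, G \in GG -> H \in GG -> G :&: H != set0 -> cl (G :|: H) \in GG
    & forall F, flat M F -> let Gm := maxels (below GG F) in
        cl (\bigcup_(G in Gm) G) = F /\ rk F = (\sum_(G in Gm) rk G)%N].

(** Generation by components is surjectivity. For joins, suppose [G] and [H] lie in different
    components [C1] and [C2] of their join: then [C1 :&: C2], placed at [C1] alone or at [C2] alone,
    gives two families with the same join, so injectivity forces it to be empty. *)
Lemma building_wbuilding GG : loopless M -> building_set M GG -> wbuilding GG.
Proof.
move=> ll [hG hF]; split=> [//|G H GG_ HG GH0|F fF Gm]; last first.
  have [[_ im _ _] ->] := hF F fF; split=> //; apply/eqP; rewrite eqEsubset.
  have sU : \bigcup_(G in Gm) G \subset F.
    apply/bigcupsP => G /(subsetP (maxels_sub _)).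
    by rewrite inE => /andP[].
  rewrite cl_min //=; have : F \in lower M F by rewrite inE fF subxx.
  rewrite -im => /imsetP[phi]; rewrite inE => /pfamilyP[_ hphi] ->.
  apply: clS; last exact: subset_trans sU (flat_sub fF).
  apply/bigcupsP => G GGm; apply: (bigcup_max G) => //.
  by have := hphi G GGm; rewrite inE => /andP[].
have [fG _] := hG G GG_; have [fH _] := hG H HG.
have sE : G :|: H \subset E by rewrite subUset !flat_sub.
set F := cl _; have fF : flat M F by apply: flat_cl.
have [[inj _ _ _] _] := hF F fF; set Gm := maxels _ in inj.
have inF C : C \in Gm -> C \in GG /\ C \subset F.
  by move=> /(subsetP (maxels_sub _)); rewrite inE => /andP[].
have [C1 C1m sG] : exists2 C, C \in Gm & G \subset C.
  by apply: maxels_above; rewrite inE GG_ (subset_trans _ (sub_cl _ _)) ?subsetUl.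
have [C2 C2m sH] : exists2 C, C \in Gm & H \subset C.
  by apply: maxels_above; rewrite inE HG (subset_trans _ (sub_cl _ _)) ?subsetUr.
have [C1G sC1] := inF _ C1m; have [C2G sC2] := inF _ C2m.
have fC1 := (hG _ C1G).1; have fC2 := (hG _ C2G).1.
have [E12|neq] := eqVneq C1 C2.
  suff -> : F = C1 by [].
  by apply/eqP; rewrite eqEsubset sC1 andbT cl_min // subUset sG E12 sH.
pose D := C1 :&: C2; have fD : flat M D by apply: flatI.
have key C : C \in Gm -> D \subset C ->
    [ffun K => if K == C then D else set0] \in lower_prod M Gm /\
    join_fam M Gm [ffun K => if K == C then D else set0] = D.
  move=> Cm sDC; split.
    rewrite inE; apply/pfamilyP; split.
      apply/subsetP => K; rewrite inE ffunE; have [->//|_] := eqVneq K C.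
      by rewrite eqxx.
    move=> K Km; rewrite ffunE inE; case: eqP => [->|_]; first by rewrite fD.
    by rewrite sub0set andbT.
  rewrite /join_fam (bigD1 C) //= ffunE eqxx big1 ?setU0 ?cl_flat //.
  by move=> K /andP[_ /negPf neqK]; rewrite ffunE neqK.
have [h1 e1] := key C1 C1m (subsetIl _ _).
have [h2 e2] := key C2 C2m (subsetIr _ _).
have := inj _ _ h1 h2; rewrite e1 e2 => /(_ erefl) /ffunP /(_ C1).
rewrite !ffunE eqxx (negPf neq) => D0; case/eqP: GH0; apply/eqP.
by rewrite -subset0 -D0; apply: setISS.
Qed.

Section Decomposition.
Variable (GG : {set {set T}}).
Hypothesis wG : wbuilding GG.

Lemma wb_flat G : G \in GG -> flat M G.
Proof. by case: wG => h _ _ /h[]. Qed.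

Lemma wb_neq0 G : G \in GG -> G != set0.
Proof. by case: wG => h _ _ /h[]. Qed.

Lemma wb_join G H : G \in GG -> H \in GG -> G :&: H != set0 ->
  cl (G :|: H) \in GG.
Proof. by case: wG => _ h _; apply: h. Qed.

Variable P : {set T}.
Hypothesis fP : flat M P.
Let Gm := maxels (below GG P).

Lemma comp_in G : G \in Gm -> G \in GG.
Proof. by move=> /(subsetP (maxels_sub _)); rewrite inE => /andP[]. Qed.

Lemma comp_sub G : G \in Gm -> G \subset P.
Proof. by move=> /(subsetP (maxels_sub _)); rewrite inE => /andP[]. Qed.

Lemma comp_flat G : G \in Gm -> flat M G.
Proof. by move=> /comp_in /wb_flat. Qed.

Lemma comp_above B : B \in GG -> B \subset P ->
  exists2 G, G \in Gm & B \subset G.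
Proof. by move=> BG sB; apply: maxels_above; rewrite inE BG. Qed.

Lemma bigcup_comp_sub (f : {set T} -> {set T}) :
  (forall G, G \in Gm -> f G \subset G) -> \bigcup_(G in Gm) f G \subset P.
Proof.
move=> hf; apply/bigcupsP => G Gi; exact: subset_trans (hf _ Gi) (comp_sub Gi).
Qed.

Lemma bigcup_comp_subE (f : {set T} -> {set T}) :
  (forall G, G \in Gm -> f G \subset G) -> \bigcup_(G in Gm) f G \subset E.
Proof. by move=> /bigcup_comp_sub /subset_trans; apply; apply: flat_sub. Qed.

Lemma cl_comp : cl (\bigcup_(G in Gm) G) = P.
Proof. by case: wG => _ _ /(_ P fP)[]. Qed.

Lemma rk_comp : rk P = (\sum_(G in Gm) rk G)%N.
Proof. by case: wG => _ _ /(_ P fP)[]. Qed.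

(* Adding the [G] one at a time to the union of the [f G] increases the rank
   by at most [rk G - rk (f G)]. *)
Lemma rk_bigcup_comp (f : {set T} -> {set T}) :
    (forall G, G \in Gm -> f G \subset G) ->
  rk (\bigcup_(G in Gm) f G) = (\sum_(G in Gm) rk (f G))%N.
Proof.
move=> hf; set A := \bigcup_(G in Gm) f G.
have sA : A \subset E := bigcup_comp_subE hf.
apply/eqP; rewrite eqn_leq; apply/andP; split.
  rewrite /A; have : forall G, G \in Gm -> f G \subset E.
    by move=> G Gi; apply: subset_trans (hf _ Gi) (flat_sub (comp_flat Gi)).
  move=> hE.
  suff [] : (rk (\bigcup_(G in Gm) f G) <= \sum_(G in Gm) rk (f G))%N /\
      \bigcup_(G in Gm) f G \subset E by [].
  elim/big_rec2: _ => [|G x B Gi [le sB]].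
    by case: pM => -> _ _; rewrite sub0set.
  split; last by rewrite subUset hE.
  by have := rk_submod (hE G Gi) sB; clear -le; lia.
have : (rk (A :|: \bigcup_(G in Gm) G) + \sum_(G in Gm) rk (f G)
    <= rk A + \sum_(G in Gm) rk G)%N /\ A :|: \bigcup_(G in Gm) G \subset E.
  have fA G : G \in Gm -> f G \subset A by move=> Gi; apply: (bigcup_max G).
  elim/big_rec3: _ => [|G x y B Gi [le sB]]; first by rewrite setU0.
  have GE := flat_sub (comp_flat Gi).
  rewrite setUCA; split; last by rewrite subUset GE.
  have := rk_submod GE sB.
  have : (rk (f G) <= rk (G :&: (A :|: B)))%N.
    apply: rk_mono; last by apply: subset_trans GE; apply: subsetIl.
    by rewrite subsetI hf //= (subset_trans (fA G Gi)) ?subsetUl.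
  by clear -le; lia.
have sAU : A \subset \bigcup_(G in Gm) G.
  by apply/bigcupsP => G Gi; apply: (bigcup_max G) => //; apply: hf.
rewrite (setUidPr sAU) -rk_cl ?cl_comp ?rk_comp; last exact: bigcup_comp_subE.
by case; rewrite addnC leq_add2r.
Qed.

(** Enlarging the entry at [G] to the trace of the join keeps the union inside the join. Ranks of
    entries add up, so the entry gains no rank, and [f G] is a flat. Together with [flat_decomp]
    this recovers the product decomposition of the interval below [P]. *)
Lemma cl_bigcup_compI (f : {set T} -> {set T}) G :
    (forall G, G \in Gm -> f G \subset G) -> flat M (f G) -> G \in Gm ->
  cl (\bigcup_(G in Gm) f G) :&: G = f G.
Proof.
move=> hf fG Gi; set Q := cl _.
have sQ : Q \subset E by apply/cl_sub/bigcup_comp_subE.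
have sfQ H : H \in Gm -> f H \subset Q.
  by move=> Hi; apply: subset_trans (sub_cl _ _); apply: (bigcup_max H).
pose f' H := if H == G then Q :&: G else f H.
have hf' H : H \in Gm -> f' H \subset H.
  by rewrite /f'; case: eqP => [-> _|_ /hf//]; apply: subsetIr.
have sI : Q :&: G \subset E by apply: subset_trans sQ; apply: subsetIl.
apply: flat_rk_eq => //; first by rewrite subsetI sfQ // hf.
have : (rk (\bigcup_(H in Gm) f' H) <= rk (\bigcup_(H in Gm) f H))%N.
  rewrite -[leqRHS]rk_cl; last exact: bigcup_comp_subE.
  apply: rk_mono => //; apply/bigcupsP => H Hi; rewrite /f'.
  by case: eqP => _; [apply: subsetIl | apply: sfQ].
rewrite !rk_bigcup_comp // (bigD1 G) //= [leqRHS](bigD1 G) //= {1}/f' eqxx.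
rewrite (eq_bigr (fun H => rk (f H))) => [|H /andP[_ /negPf neq]].
  by rewrite leq_add2r.
by rewrite /f' neq.
Qed.

(** The members of [GG] inside [F] generate [F], and each lies in one component of [P], hence in the
    trace of [F] on it. *)
Lemma flat_decomp F : flat M F -> F \subset P ->
  cl (\bigcup_(G in Gm) (F :&: G)) = F.
Proof.
move=> fF sFP; apply/eqP; rewrite eqEsubset cl_min //=; last first.
  by apply/bigcupsP => G _; apply: subsetIl.
case: wG => _ _ /(_ F fF)[E1 _].
suff : cl (\bigcup_(G in maxels (below GG F)) G) \subset
    cl (\bigcup_(G in Gm) (F :&: G)) by rewrite E1.
apply: clS; last first.
  by apply: bigcup_comp_subE => G _; apply: subsetIr.
apply/bigcupsP => B /(subsetP (maxels_sub _)); rewrite inE => /andP[BG sBF].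
have [G Gi sBG] := comp_above BG (subset_trans sBF sFP).
by apply: (bigcup_max G) => //; rewrite subsetI sBF.
Qed.

Lemma rk_decomp F : flat M F -> F \subset P ->
  rk F = (\sum_(G in Gm) rk (F :&: G))%N.
Proof.
move=> fF sFP; rewrite -{1}(flat_decomp fF sFP) rk_cl.
  by rewrite rk_bigcup_comp // => G _; apply: subsetIr.
by apply: bigcup_comp_subE => G _; apply: subsetIr.
Qed.

End Decomposition.
End Closure.

(** * Join of a component with a flat *)

Section ComponentJoin.
Variables (T : finType) (M : rankData T) (GG : {set {set T}}) (P F : {set T}).
Hypotheses (pM : polymatroid M) (wG : wbuilding M GG).
Hypotheses (fP : flat M P) (fF : flat M F) (sFP : F \subset P).
Implicit Types (B C H K : {set T}).
Local Notation Gm := (maxels (below GG P)).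

Lemma compU_sub C : C \in Gm -> C :|: F \subset P.
Proof. by move=> Cm; rewrite subUset sFP (comp_sub Cm). Qed.

Lemma compU_subE C : C \in Gm -> C :|: F \subset gset M.
Proof. by move=> /compU_sub /subset_trans; apply; apply: flat_sub. Qed.

Lemma flat_clU C : C \in Gm -> flat M (cl M (C :|: F)).
Proof. by move=> Cm; apply/flat_cl/compU_subE. Qed.

(** In the product decomposition, joining [F] with [C] only changes the coordinate at [C], which
    becomes [C]; this is the family [f]. *)
Lemma cl_compU_compI C K : C \in Gm -> K \in Gm -> K != C ->
  cl M (C :|: F) :&: K = F :&: K.
Proof.
move=> Cm Km neq; pose f H := if H == C then C else F :&: H.
have hf H : H \in Gm -> f H \subset H.
  by move=> _; rewrite /f; case: eqP => [->//|_]; apply: subsetIr.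
have fK : f K = F :&: K by rewrite /f (negPf neq).
have <- : cl M (\bigcup_(H in Gm) f H) :&: K = F :&: K.
  rewrite (cl_bigcup_compI pM wG fP hf) ?fK //.
  by apply: flatI => //; apply: comp_flat Km.
congr (_ :&: K); have sUE := bigcup_comp_subE fP hf.
apply/eqP; rewrite eqEsubset; apply/andP; split; apply: cl_min.
- exact: flat_cl.
- rewrite subUset; apply/andP; split.
    apply: subset_trans (sub_cl _ _); apply: (bigcup_max C) => //.
    by rewrite /f eqxx.
  rewrite -[X in pred_of_set X](flat_decomp pM wG fP fF sFP).
  apply: clS => //; apply/bigcupsP => H Hm; apply: (bigcup_max H) => //.
  by rewrite /f; case: eqP => [->|_ //]; apply: subsetIr.
- exact: flat_clU.
- apply/bigcupsP => H Hm; apply: subset_trans (sub_cl _ _).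
  rewrite /f; case: eqP => _; first exact: subsetUl.
  by apply: subset_trans (subsetUr _ _); apply: subsetIl.
Qed.

Lemma rk_cl_compU C : C \in Gm ->
  (rk M (cl M (C :|: F)) + rk M (F :&: C) = rk M C + rk M F)%N.
Proof.
move=> Cm; have sclP : cl M (C :|: F) \subset P by apply/cl_min/compU_sub.
rewrite (rk_decomp pM wG fP (flat_clU Cm) sclP) (rk_decomp pM wG fP fF sFP).
rewrite (bigD1 C) //= [in RHS](bigD1 C) //=.
have -> : cl M (C :|: F) :&: C = C.
  by apply/setIidPr; apply: subset_trans (sub_cl _ _); apply: subsetUl.
rewrite (eq_bigr (fun K => rk M (F :&: K))).
  by rewrite -addnA; congr (_ + _)%N; rewrite addnC.
by move=> K /andP[Km neq]; rewrite cl_compU_compI.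
Qed.

Lemma cl_compU_inj C K : C \in Gm -> K \in Gm -> ~~ (K \subset F) ->
  K \subset cl M (C :|: F) -> K = C.
Proof.
move=> Cm Km nKF sK; apply/eqP; apply: contraNT nKF => neq.
have := cl_compU_compI Cm Km neq; rewrite (setIidPr sK) => ->.
exact: subsetIl.
Qed.

End ComponentJoin.

(** * Minors and induced building sets *)

Section Minors.
Variables (T : finType) (M : rankData T) (GG : {set {set T}}) (F G : {set T}).
Hypotheses (pM : polymatroid M) (wG : wbuilding M GG).
Hypotheses (fF : flat M F) (fG : flat M G) (sFG : F \subset G).
Implicit Types (A B C H K P : {set T}).
Let N := minor M F G.
Let GG' := minor_building M GG F G.
Let sFE : F \subset gset M := flat_sub fF.
Let sGE : G \subset gset M := flat_sub fG.

Lemma minor_pm : polymatroid N.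
Proof. exact: minor_polymatroid. Qed.

Lemma subD_U A : A \subset G :\: F -> A :|: F \subset G.
Proof. by move=> sA; rewrite subUset sFG (subset_trans sA) ?subsetDl. Qed.

Lemma subD_UE A : A \subset G :\: F -> A :|: F \subset gset M.
Proof. by move=> /subD_U /subset_trans; apply. Qed.

Lemma subD_UDK A : A \subset G :\: F -> (A :|: F) :\: F = A.
Proof.
move=> sA; rewrite setDUl setDv setU0; apply/setDidPl.
by move: sA; rewrite subsetD => /andP[].
Qed.

Lemma setDUK A : F \subset A -> (A :\: F) :|: F = A.
Proof.
move=> sFA; apply/setP => x; rewrite !inE.
by have := subsetP sFA x; case: (x \in F) => //= [->|_] //; rewrite orbF.
Qed.

Lemma minor_flat_sub A : flat N A -> A \subset G :\: F.
Proof. by move/flat_sub. Qed.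

Lemma minor_flatU A : flat N A -> flat M (A :|: F).
Proof. by move=> fA; rewrite -(flat_minor pM fF fG) // minor_flat_sub. Qed.

Lemma minor_flatD H : flat M H -> F \subset H -> H \subset G ->
  flat N (H :\: F).
Proof.
by move=> fH sFH sHG; rewrite (flat_minor pM fF fG) ?setSD // setDUK.
Qed.

Lemma minor_loopless : loopless N.
Proof.
by rewrite /loopless (flat_minor pM fF fG) ?sub0set // set0U.
Qed.

Lemma cl_minor A : A \subset G :\: F -> cl N A = cl M (A :|: F) :\: F.
Proof.
move=> sA; have fcl : flat M (cl M (A :|: F)) by apply/flat_cl/subD_UE.
have sFcl : F \subset cl M (A :|: F).
  by apply: subset_trans (sub_cl _ _); apply: subsetUr.
apply/eqP; rewrite eqEsubset; apply/andP; split.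
  apply: cl_min; first by apply: minor_flatD => //; apply/cl_min/subD_U.
  rewrite -{1}(subD_UDK sA); apply: setSD; exact: sub_cl.
have fclN : flat N (cl N A) by apply: flat_cl; first exact: minor_pm.
rewrite -(subD_UDK (minor_flat_sub fclN)); apply: setSD; apply: cl_min.
  exact: minor_flatU.
by apply: setSU; apply: sub_cl.
Qed.

Lemma minor_buildingP A : reflect
  (exists H, [/\ H \in GG, H \subset G, ~~ (H \subset F) & A = cl M (H :|: F) :\: F])
  (A \in GG').
Proof.
apply: (iffP imsetP) => [[H]|[H [HG sH nH ->]]].
  by rewrite inE => /and3P[HG sH nH] ->; exists H.
by exists H => //; rewrite inE HG sH.
Qed.

Section Top.
Variable P : {set T}.
Hypotheses (fP : flat M P) (sFP : F \subset P) (sPG : P \subset G).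
Local Notation Gm := (maxels (below GG P)).

Lemma cl_subP H : H \subset P -> cl M (H :|: F) \subset P.
Proof. by move=> sH; apply: cl_min => //; rewrite subUset sH. Qed.

(** By [cl_compU_inj], joining with [F] keeps the components that are not inside [F] pairwise
    incomparable, so none of their images is lost among the maximal members. *)
Lemma maxels_minor : maxels (below GG' (P :\: F)) =
  [set cl M (C :|: F) :\: F | C in Gm & ~~ (C \subset F)].
Proof.
have clF C : F \subset cl M (C :|: F).
  by apply: subset_trans (sub_cl _ _); apply: subsetUr.
have sub2 C K : cl M (C :|: F) :\: F \subset cl M (K :|: F) :\: F ->
    C \subset cl M (K :|: F).
  move=> s; have := setSU F s; rewrite !setDUK // => /(subset_trans _); apply.
  by apply: subset_trans (sub_cl _ _); apply: subsetUl.
have below_ex A : A \in below GG' (P :\: F) ->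
    exists2 C, (C \in Gm) && ~~ (C \subset F) & A \subset cl M (C :|: F) :\: F.
  rewrite inE => /andP[/minor_buildingP[H [HG sH nH ->]] sHP].
  have sHP' : H \subset P.
    have := setSU F sHP; rewrite !setDUK // => /(subset_trans _); apply.
    by apply: subset_trans (sub_cl _ _); apply: subsetUl.
  have [C Cm sHC] := comp_above HG sHP'; exists C.
    by rewrite Cm; apply: contra nH; apply: subset_trans.
  apply: setSD; apply: clS => //; first exact: setSU.
  exact: compU_subE Cm.
have in_below C : C \in Gm -> ~~ (C \subset F) ->
    cl M (C :|: F) :\: F \in below GG' (P :\: F).
  move=> Cm nC; rewrite inE; apply/andP; split.
    apply/minor_buildingP; exists C; split=> //; first exact: comp_in Cm.
    by apply: subset_trans sPG; apply: comp_sub Cm.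
  by apply: setSD; apply: cl_subP; apply: comp_sub Cm.
apply/setP => A; apply/idP/imsetP.
  rewrite inE => /andP[Ab nA]; have [C /andP[Cm nC] sA] := below_ex A Ab.
  exists C; first by rewrite inE Cm.
  apply/eqP; apply: contraNT nA => neq; apply/existsP.
  by exists (cl M (C :|: F) :\: F); rewrite in_below // properEneq neq.
move=> [C /setIdP[Cm nC] ->]; rewrite inE in_below //=.
apply/existsP => -[A' /andP[/below_ex[K /andP[Km nK] sK] ltA']].
have sCK := sub2 _ _ (subset_trans (proper_sub ltA') sK).
have eCK := cl_compU_inj pM wG fP fF sFP Km Cm nC sCK.
by move: (proper_sub_trans ltA' sK); rewrite eCK properxx.
Qed.

Lemma minor_comp_inj : {in [set C in Gm | ~~ (C \subset F)] &,
  injective (fun C => cl M (C :|: F) :\: F)}.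
Proof.
move=> C K /setIdP[Cm nC] /setIdP[Km nK] eqCK.
have clF H : F \subset cl M (H :|: F).
  by apply: subset_trans (sub_cl _ _); apply: subsetUr.
have eqcl : cl M (C :|: F) = cl M (K :|: F).
  by rewrite -(setDUK (clF C)) eqCK setDUK.
apply: (cl_compU_inj pM wG fP fF sFP Km Cm nC); rewrite -eqcl.
by apply: subset_trans (sub_cl _ _); apply: subsetUl.
Qed.

End Top.

Lemma wbuilding_minor : wbuilding N GG'.
Proof.
have clF C : F \subset cl M (C :|: F).
  by apply: subset_trans (sub_cl _ _); apply: subsetUr.
have clC C : C \subset cl M (C :|: F).
  by apply: subset_trans (sub_cl _ _); apply: subsetUl.
have UFE H : H \subset G -> H :|: F \subset gset M.
  by move=> sH; rewrite subUset sFE (subset_trans sH).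
split.
- move=> A /minor_buildingP[H [HG sH nH ->]]; split.
    apply: minor_flatD => //; first exact/flat_cl/UFE.
    by apply: cl_min => //; rewrite subUset sH.
  by rewrite setD_eq0; apply: contra nH; apply: subset_trans.
- move=> _ _ /minor_buildingP[H [HG sH nH ->]] /minor_buildingP[L [LG sL nL ->]].
  set P := cl M (H :|: F); set Q := cl M (L :|: F).
  have fP : flat M P by apply/flat_cl/UFE.
  have fQ : flat M Q by apply/flat_cl/UFE.
  have sPG : P \subset G by apply: cl_min; rewrite // subUset sH.
  have sQG : Q \subset G by apply: cl_min; rewrite // subUset sL.
  case/set0Pn => x; rewrite !inE => /andP[/andP[xF xP] /andP[_ xQ]].
  have fR : flat M (P :&: Q) by apply: flatI.
  (* The flat [P :&: Q] contains [x] outside [F] and is generated by its components, so one of them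
     is not inside [F]. *)
  have [B] : exists B, (B \in below GG (P :&: Q)) && ~~ (B \subset F).
    apply/existsP; apply: contraNT xF => /existsPn hB.
    have E1 := cl_comp wG fR.
    have : x \in P :&: Q by rewrite inE xP.
    rewrite -E1; apply/subsetP; apply: cl_min => //; apply/bigcupsP => B.
    move=> /(subsetP (maxels_sub _)) Bb; have := hB B.
    by rewrite Bb /= negbK.
  rewrite inE subsetI => /andP[/and3P[BG sBP sBQ] nBF].
  (* [H] and [L] may be disjoint even though their images meet. Each is enlarged to a member with
     the same join with [F] that contains [B]: the component of that join around it, which is the
     only component not inside [F]. *)
  have main L' : L' \in GG -> L' \subset G -> ~~ (L' \subset F) ->
      B \subset cl M (L' :|: F) -> exists C, [/\ C \in GG, B \subset C, C \subset G
        & cl M (C :|: F) = cl M (L' :|: F)].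
    move=> LG' sL' nL' sB; set W := cl M _ in sB *.
    have fW : flat M W by apply/flat_cl/UFE.
    have sFW : F \subset W by apply: clF.
    have sWG : W \subset G by apply: cl_min; rewrite // subUset sL'.
    have [C Cm sLC] := comp_above LG' (clC L').
    have [K Km sBK] := comp_above BG sB.
    have CG := comp_in Cm; have sCW := comp_sub Cm.
    have WE : cl M (C :|: F) = W.
      apply/eqP; rewrite eqEsubset cl_min ?subUset ?sCW //=.
      by apply: clS => //; [exact: setSU | exact/UFE/(subset_trans sCW)].
    exists C; split=> //; last exact: subset_trans sWG.
    have <- // : K = C; apply: (cl_compU_inj pM wG fW fF sFW) => //.
      by apply: contra nBF; apply: subset_trans.
    by rewrite WE; apply: comp_sub Km.
  have [C [CG sBC sCG clCE]] := main H HG sH nH sBP.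
  have [K [KG sBK sKG clKE]] := main L LG sL nL sBQ.
  have CK0 : C :&: K != set0.
    apply: contraNneq nBF => CK0; apply: subset_trans (sub0set F).
    by rewrite -CK0 subsetI sBC.
  have JG := wb_join wG CG KG CK0.
  have sJG : cl M (C :|: K) \subset G by apply: cl_min; rewrite // subUset sCG.
  rewrite cl_minor; last by rewrite subUset !setSD.
  apply/minor_buildingP; exists (cl M (C :|: K)); split=> //.
    apply: contra nBF; apply: subset_trans; apply: subset_trans sBC _.
    by apply: subset_trans (sub_cl _ _); apply: subsetUl.
  have sFP : F \subset P by apply: clF.
  have sFQ : F \subset Q by apply: clF.
  congr (_ :\: F); rewrite setUUl !setDUK //.
  have sPQ : P :|: Q \subset gset M by rewrite subUset !flat_sub.
  have sJE : cl M (C :|: K) :|: F \subset gset M by apply: UFE.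
  apply/eqP; rewrite eqEsubset; apply/andP; split; apply: cl_min; try exact: flat_cl.
    have sub (X : {set T}) : X \subset C :|: K ->
        cl M (X :|: F) \subset cl M (cl M (C :|: K) :|: F).
      move=> sX; apply: clS => //; apply: setSU; exact: subset_trans (sub_cl _ _).
    by rewrite subUset /P /Q -clCE -clKE !sub ?subsetUl ?subsetUr.
  have sPc : P \subset cl M (P :|: Q)
    by apply: subset_trans (sub_cl _ _); apply: subsetUl.
  have sQc : Q \subset cl M (P :|: Q)
    by apply: subset_trans (sub_cl _ _); apply: subsetUr.
  rewrite subUset (subset_trans (clF H) sPc) andbT.
  apply: cl_min; first exact: flat_cl.
  rewrite subUset; apply/andP; split.
    by apply: subset_trans sPc; rewrite /P -clCE.
  by apply: subset_trans sQc; rewrite /Q -clKE.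
- move=> A fA; have fP := minor_flatU fA; set P := A :|: F in fP.
  have sA := minor_flat_sub fA.
  have AE : A = P :\: F by rewrite subD_UDK.
  have sFP : F \subset P by apply: subsetUr.
  have sPG : P \subset G by apply: subD_U.
  set Gm := maxels (below GG P) => Gm'.
  have Gm'E : Gm' = [set cl M (C :|: F) :\: F | C in Gm & ~~ (C \subset F)].
    by rewrite /Gm' AE maxels_minor.
  split.
    have sU : \bigcup_(B in Gm') B \subset A.
      apply/bigcupsP => B /(subsetP (maxels_sub _)).
      by rewrite inE => /andP[].
    rewrite cl_minor; last exact: subset_trans sA.
    rewrite [RHS]AE; congr (_ :\: F); apply/eqP; rewrite eqEsubset.
    rewrite cl_min //=; last exact: setSU.
    rewrite -[X in pred_of_set X](cl_comp wG fP); apply: clS => //; last first.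
      by apply: subD_UE; apply: subset_trans sA.
    apply/bigcupsP => C Cm; have [sCF|nCF] := boolP (C \subset F).
      by apply: subset_trans sCF _; apply: subsetUr.
    apply: subset_trans (clC C) _; rewrite -(setDUK (clF C)); apply: setSU.
    apply: (bigcup_max (cl M (C :|: F) :\: F)) => //.
    by rewrite Gm'E; apply/imsetP; exists C; rewrite // inE Cm.
  (* The ranks of [P] and [F] are both sums over the components of [P]: those inside [F] cancel, and
     for the others [rk_cl_compU] identifies the difference with the rank in the minor. *)
  rewrite Gm'E big_imset /=; last exact: minor_comp_inj.
  rewrite -/P (rk_comp wG fP) [in LHS](rk_decomp pM wG fP fF sFP).
  rewrite -/Gm (eq_bigl (fun C => (C \in Gm) && ~~ (C \subset F))); last first.
    by move=> C; rewrite inE.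
  rewrite (bigID (fun C => C \subset F)) /=
    [X in (_ - X)%N](bigID (fun C => C \subset F)) /=.
  rewrite [X in (_ - (X + _))%N](eq_bigr (rk M)); last first.
    by move=> C /andP[_ sCF]; rewrite (setIidPr sCF).
  rewrite subnDl -sumnB => [|C /andP[Cm _]]; last first.
    apply: rk_mono; rewrite ?subsetIr //.
    exact: flat_sub (comp_flat wG Cm).
  apply: eq_bigr => C /andP[Cm _]; rewrite setDUK //.
  have := rk_cl_compU pM wG fP fF sFP Cm.
  have : (rk M (F :&: C) <= rk M C)%N.
    by apply: rk_mono; rewrite ?subsetIr // (flat_sub (comp_flat wG Cm)).
  clear; lia.
Qed.

(** An equality of records rather than of ranks on the ground set, so that it can be rewritten
    inside the Chow ring and the characteristic polynomial. *)
Lemma minor_minor A B : A \subset G :\: F -> B \subset G :\: F ->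
  minor N A B = minor M (A :|: F) (B :|: F).
Proof.
move=> sA sB; congr RankData.
  apply/setP => x; rewrite !inE; have := subsetP sB x; rewrite !inE.
  by case: (x \in B) (x \in F) (x \in A) => [] [] [] //= /(_ isT).
apply/funext => X /=; rewrite setUA.
have : (rk M F <= rk M (A :|: F))%N.
  by apply: rk_mono; rewrite ?subsetUr ?subD_UE.
clear; lia.
Qed.

Lemma minor_building_minor A B : flat N A -> flat N B -> A \subset B ->
  minor_building N GG' A B = minor_building M GG (A :|: F) (B :|: F).
Proof.
move=> fA fB sAB; have sA := minor_flat_sub fA; have sB := minor_flat_sub fB.
have fBF := minor_flatU fB; have fAF := minor_flatU fA.
have UFE H : H \subset G -> H :|: F \subset gset M.
  by move=> sH; rewrite subUset sFE (subset_trans sH).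
have clF C : F \subset cl M (C :|: F).
  by apply: subset_trans (sub_cl _ _); apply: subsetUr.
have clC C : C \subset cl M (C :|: F).
  by apply: subset_trans (sub_cl _ _); apply: subsetUl.
have valE H : H \in GG -> H \subset G ->
    join N (cl M (H :|: F) :\: F) A :\: A = join M H (A :|: F) :\: (A :|: F).
  move=> HG sH; have sclG : cl M (H :|: F) \subset G.
    by apply: cl_min; rewrite // subUset sH.
  rewrite /join cl_minor; last by rewrite subUset sA setSD.
  rewrite setDDl (setUC F A); congr (_ :\: _).
  rewrite setUAC setDUK //.
  have sHA : H :|: (A :|: F) \subset gset M.
    by rewrite subUset subD_UE ?andbT // (subset_trans sH).
  have sHA' : cl M (H :|: F) :|: A \subset gset M.
    by rewrite subUset !(subset_trans _ sGE) // (subset_trans sA) ?subsetDl.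
  apply/eqP; rewrite eqEsubset; apply/andP; split; apply: cl_min; try exact: flat_cl.
    rewrite subUset; apply/andP; split.
      by apply: clS => //; apply: setUS; apply: subsetUr.
    apply: subset_trans (sub_cl _ _); rewrite setUCA; exact: subsetUl.
  apply: subset_trans (sub_cl _ _); rewrite setUCA setUC; apply: setSU.
  exact: sub_cl.
have condE H X : flat N X ->
    (cl M (H :|: F) :\: F \subset X) = (H \subset X :|: F).
  move=> fX; have sX := minor_flat_sub fX; apply/idP/idP => s.
    have := setSU F s; rewrite setDUK // => /(subset_trans _); apply; exact: clC.
  rewrite -(subD_UDK sX); apply: setSD; apply: cl_min; first exact: minor_flatU.
  by rewrite subUset s subsetUr.
apply/setP => X; apply/imsetP/imsetP => -[H].
  rewrite inE => /and3P[/minor_buildingP[L [LG sL nL ->]] s1 s2] ->.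
  exists L; last exact: valE.
  by rewrite inE LG -!condE // s1.
rewrite inE => /and3P[HG sHB nHA] ->.
have sHG : H \subset G by apply: subset_trans sHB (subD_U sB).
exists (cl M (H :|: F) :\: F); last by rewrite valE.
rewrite inE !condE // sHB nHA !andbT; apply/minor_buildingP; exists H; split=> //.
by apply: contra nHA => /subset_trans; apply; apply: subsetUr.
Qed.

End Minors.

(** * One-sided inverses under convolution are two-sided *)

Lemma kernel_mul1C (I : finType) (R : comUnitRingType) (f g : I -> I -> R) :
    (forall i j, \sum_k f i k * g k j = (i == j)%:R) ->
  forall i j, \sum_k g i k * f k j = (i == j)%:R.
Proof.
move=> fg; pose mx (h : I -> I -> R) : 'M_#|I| :=
  \matrix_(i, j) h (enum_val i) (enum_val j).
have mulE h h' i j : (mx h *m mx h') i j = \sum_k h (enum_val i) k * h' k (enum_val j).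
  rewrite mxE [RHS](reindex (enum_val (A := I))) /=; last exact/onW_bij/enum_val_bij.
  by apply: eq_bigr => k _; rewrite !mxE.
have /mulmx1C gf : mx f *m mx g = 1%:M.
  by apply/matrixP => i j; rewrite mulE fg (inj_eq enum_val_inj) mxE.
move=> i j; have /matrixP/(_ (enum_rank i) (enum_rank j)) := gf.
by rewrite mulE !enum_rankK mxE (inj_eq enum_rank_inj).
Qed.

Section FlatConvolution.
Variables (T : finType) (M : rankData T) (R : comUnitRingType).
Implicit Types (a b : {set T} -> {set T} -> R) (F G H : {set T}).

(** Extending by the identity on sets that are not flats turns convolution into a product of square
    matrices indexed by all of [{set T}]. *)
Definition flat_kernel a F G : R :=
  if flat M F && flat M G then (if F \subset G then a F G else 0) else (F == G)%:R.

Lemma flat_kernel_mul a b F G :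
  \sum_H flat_kernel a F H * flat_kernel b H G =
  flat_kernel (fun F G =>
    \sum_(H | [&& flat M H, F \subset H & H \subset G]) a F H * b H G) F G.
Proof.
rewrite /flat_kernel; have [fF|nF] := boolP (flat M F); last first.
  rewrite (bigD1 F) //= eqxx mul1r (negPf nF) /= big1 ?addr0 // => H HF.
  by rewrite eq_sym (negPf HF) mul0r.
have [fG|nG] := boolP (flat M G); last first.
  rewrite (bigD1 G) //= (negPf nG) !andbF /= eqxx mulr1 big1 ?addr0 // => H HG.
  by rewrite andbF (negPf HG) mulr0.
case: ifP => sFG; last first.
  rewrite big1 // => H _; rewrite andbT; case: (boolP (flat M H)) => fH /=.
    case: ifP => sFH; rewrite ?mul0r //; case: ifP => sHG; rewrite ?mulr0 //.
    by rewrite (subset_trans sFH sHG) in sFG.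
  by case: eqP => [FH|_]; [rewrite -FH fF in fH | rewrite mul0r].
rewrite [RHS]big_mkcond /=; apply: eq_bigr => H _.
case: (boolP (flat M H)) => fH /=.
  by case: ifP => _; case: ifP => _; rewrite ?mul0r ?mulr0.
by case: eqP => [FH|_]; [rewrite -FH fF in fH | rewrite mul0r].
Qed.

Lemma flat_convC a b :
    (forall F G, flat M F -> flat M G -> F \subset G ->
       \sum_(H | [&& flat M H, F \subset H & H \subset G]) a F H * b H G
         = (F == G)%:R) ->
  forall F G, flat M F -> flat M G -> F \subset G ->
     \sum_(H | [&& flat M H, F \subset H & H \subset G]) b F H * a H G
       = (F == G)%:R.
Proof.
move=> ab F G fF fG sFG.
have /kernel_mul1C/(_ F G) : forall F G,
    \sum_H flat_kernel a F H * flat_kernel b H G = (F == G)%:R.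
  move=> F' G'; rewrite flat_kernel_mul /flat_kernel.
  case: ifP => // /andP[fF' fG']; case: ifP => [|nsub]; first exact: ab.
  by case: eqP => // FG; rewrite FG subxx in nsub.
by rewrite flat_kernel_mul /flat_kernel fF fG sFG.
Qed.

End FlatConvolution.

(** * Möbius inversion and characteristic polynomials of minors *)

Section Mobius.
Variables (T : finType) (M : rankData T).
Hypothesis pM : polymatroid M.
Implicit Types (A B F G H K : {set T}).

Lemma mobius_sum F K : flat M F -> flat M K -> F \subset K ->
  \sum_(H | [&& flat M H, F \subset H & H \subset K]) mobius M F H = (F == K)%:R.
Proof.
move=> fF fK sFK; rewrite (bigD1 K) ?fK ?sFK ?subxx //= mobiusE //.
have -> : \sum_(H | [&& flat M H, F \subset H & H \subset K] && (H != K)) mobius M F H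
    = \sum_(H | [&& flat M H, F \subset H & H \proper K]) mobius M F H.
  by apply: eq_bigl => H; rewrite properEneq -!andbA [(H != K) && _]andbC.
case: eqP => [->|_]; last by rewrite addNr.
rewrite big1 ?addr0 // => H /and3P[_ sKH /proper_sub_trans /(_ sKH)].
by rewrite properxx.
Qed.

Lemma mobius_sum_dual F K : flat M F -> flat M K -> F \subset K ->
  \sum_(H | [&& flat M H, F \subset H & H \subset K]) mobius M H K = (F == K)%:R.
Proof.
move=> fF fK sFK.
have := @flat_convC T M int (mobius M) (fun _ _ => 1) _ F K fF fK sFK.
under eq_bigr do rewrite mul1r; apply=> F' G' fF' fG' sFG.
by under eq_bigr do rewrite mulr1; apply: mobius_sum.
Qed.

Lemma big_minor (V : nmodType) F G (Q : pred {set T}) (f : {set T} -> V) :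
    flat M F -> flat M G -> F \subset G ->
  \sum_(A | flat (minor M F G) A && Q A) f A =
  \sum_(K | [&& flat M K, F \subset K, K \subset G & Q (K :\: F)]) f (K :\: F).
Proof.
move=> fF fG sFG.
rewrite (reindex_onto (fun K => K :\: F) (fun A => A :|: F)) /=; last first.
  by move=> A /andP[fA _]; apply: (subD_UDK (minor_flat_sub fA)).
apply: eq_bigl => K; apply/idP/idP.
  case/andP=> /andP[fKF ->] /eqP KE; have := minor_flatU pM fF fG sFG fKF.
  rewrite KE => -> /=; rewrite andbT; apply/andP; split; rewrite -KE ?subsetUr //.
  by rewrite (subD_U sFG) //; apply: minor_flat_sub fKF.
case/and4P=> fK sFK sKG ->; rewrite (minor_flatD pM fF fG sFG) //=.
by rewrite setDUK.
Qed.

Lemma mobius_minor F G A : flat M F -> flat M G -> F \subset G ->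
  flat (minor M F G) A -> mobius (minor M F G) set0 A = mobius M F (A :|: F).
Proof.
move=> fF fG sFG; have [n] := ubnP #|A|; elim: n A => // n IHn A leA fA.
have sA := minor_flat_sub fA.
rewrite !mobiusE ?sub0set ?subsetUr //.
have -> : (set0 == A) = (F == A :|: F).
  by rewrite -{1}(subD_UDK sA) eq_sym setD_eq0 eqEsubset subsetUr.
case: eqP => // _; congr (- _).
rewrite (eq_bigl (fun B => flat (minor M F G) B && (B \proper A))); last first.
  by move=> B; rewrite sub0set.
rewrite (big_minor (fun B => B \proper A)) //.
have AE := subD_UDK sA.
have properE' K : F \subset K -> (K :\: F \proper A) = (K \proper A :|: F).
  move=> sFK; rewrite !properE; congr (_ && ~~ _); apply/idP/idP => s.
  - by rewrite -(setDUK sFK) setSU.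
  - by rewrite -AE setSD.
  - by rewrite -(setDUK sFK) setSU.
  - by rewrite -AE setSD.
have sAG := subD_U sFG sA.
apply: eq_big => [K|K /and4P[fK sFK sKG ltK]].
  case: (flat M K) => //=; case: (boolP (F \subset K)) => //= sFK.
  rewrite properE' //; case: (boolP (K \proper _)) => ltK; rewrite ?andbF //.
  by rewrite (subset_trans (proper_sub ltK)).
rewrite IHn ?setDUK //; last exact: minor_flatD.
exact: leq_trans (proper_card ltK) leA.
Qed.

Lemma char_poly_minor H G : flat M H -> flat M G -> H \subset G ->
  char_poly_pm (minor M H G) =
  \sum_(K | [&& flat M K, H \subset K & K \subset G])
    (mobius M H K)%:~R *: 'X^(rk M G - rk M K).
Proof.
move=> fH fG sHG; rewrite /char_poly_pm.
rewrite (eq_bigl (fun A => flat (minor M H G) A && xpredT A)); last first.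
  by move=> A; rewrite andbT.
rewrite big_minor //; apply: eq_big => [K|K]; first by rewrite andbT.
case/and4P=> fK sHK sKG _; rewrite mobius_minor ?minor_flatD // setDUK //.
rewrite /= !setDUK //; congr (_ *: 'X^_).
have : (rk M H <= rk M K)%N by apply: rk_mono => //; apply: flat_sub.
by clear; lia.
Qed.

(** After exchanging the sums, the coefficient attached to [K] is the sum of [mobius M H K] over the
    flats [H] between [F] and [K], which vanishes unless [K = F]. *)
Lemma char_poly_sum F G : flat M F -> flat M G -> F \subset G ->
  \sum_(H | [&& flat M H, F \subset H & H \subset G]) char_poly_pm (minor M H G)
  = 'X^(rk M G - rk M F).
Proof.
move=> fF fG sFG.
under eq_bigr => H /and3P[fH _ sHG] do rewrite char_poly_minor //.
rewrite (exchange_big_dep (fun K => [&& flat M K, F \subset K & K \subset G])) /=;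
    last first.
  move=> H K /and3P[_ sFH sHG] /and3P[-> sHK ->].
  by rewrite (subset_trans sFH sHK).
have sumK K : flat M K -> F \subset K -> K \subset G ->
   \sum_(H | [&& flat M H, F \subset H & H \subset G] &&
            [&& flat M K, H \subset K & K \subset G])
      (mobius M H K)%:~R *: 'X^(rk M G - rk M K)
   = (F == K)%:R *: 'X^(rk M G - rk M K) :> {poly rat}.
  move=> fK sFK sKG; rewrite -scaler_suml -(raddf_sum (intr : {additive int -> rat})).
  rewrite -(rmorph_nat (intr : {rmorphism int -> rat})) -(mobius_sum_dual fF fK sFK).
  congr (intr _ *: _); apply: eq_bigl => H; rewrite fK sKG andbT.
  case: (flat M H) => //=; case: (F \subset H) => //=.
  by case: (boolP (H \subset K)) => sHK; rewrite ?andbF // (subset_trans sHK).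
rewrite (eq_bigr (fun K => (F == K)%:R *: 'X^(rk M G - rk M K))); last first.
  by move=> K /and3P[fK sFK sKG]; apply: sumK.
rewrite (bigD1 F) ?fF ?subxx ?sFG //= eqxx scale1r big1 ?addr0 // => K.
by case/andP=> _ KF; rewrite eq_sym (negPf KF) scale0r.
Qed.

(** Möbius inversion as a uniqueness statement, by induction from the largest flats downwards. *)
Lemma up_sum_inj (V : zmodType) (f g : {set T} -> V) :
    (forall F, flat M F ->
       \sum_(H | flat M H && (F \subset H)) f H =
       \sum_(H | flat M H && (F \subset H)) g H) ->
  forall F, flat M F -> f F = g F.
Proof.
move=> fg F; have [n] := ubnP #|~: F|; elim: n F => // n IHn F leF fF.
have := fg F fF; rewrite (bigD1 F) ?fF ?subxx //= [RHS](bigD1 F) ?fF ?subxx //=.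
rewrite [X in _ + X = _](eq_bigr g); first exact: addIr.
move=> H /andP[/andP[fH sFH] HF]; apply: IHn => //.
move: leF; rewrite ltnS; apply: leq_trans.
by apply: proper_card; rewrite properC properEneq sFH eq_sym HF.
Qed.

End Mobius.

(** * The Hilbert series as a sum over standard monomials *)

Section StandardFunctions.
Variables (T : finType) (L : nat).
Implicit Types (phi psi : {ffun {set T} -> 'I_L.+1}) (B C : {set T}).

Definition fsup phi B : {set T} :=
  \bigcup_(C | ((phi C : nat) != 0%N) && (C \proper B)) C.

Definition fdeg phi : nat := (\sum_B phi B)%N.

(** Exponents are indexed by all of [{set T}] and bounded by [L], so the standard monomials of all
    lower intervals share one finite type and sums over them can be exchanged. *)
Definition stdfun (N : rankData T) (BB : {set {set T}}) phi : bool :=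
  [forall B, if B \in BB then (phi B < rk N B - rk N (fsup phi B))%N
             else (phi B : nat) == 0%N].

Lemma stdfunP (N : rankData T) (BB : {set {set T}}) phi : reflect
  ((forall B, B \in BB -> (phi B < rk N B - rk N (fsup phi B))%N) /\
   (forall B, B \notin BB -> phi B = 0%N :> nat)) (stdfun N BB phi).
Proof.
apply: (iffP forallP) => [h|[h1 h2] B]; last first.
  by case: ifPn => [/h1|/h2 ->].
split=> B hB; have := h B; first by rewrite hB.
by rewrite (negPf hB) => /eqP.
Qed.

Section Hilbert.
Variables (N : rankData T) (BB : {set {set T}}).
Hypotheses (pN : polymatroid N) (wB : wbuilding N BB).
Hypothesis rkL : forall B, B \in BB -> (rk N B <= L)%N.

Let v (i : 'I_#|BB|) : {set T} := enum_val i.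

Let compatible (m : 'X_{1..#|BB|}) phi : Prop :=
  (forall i, m i = phi (v i)) /\ (forall B, B \notin BB -> phi B = 0%N :> nat).

Lemma compatible_standard m phi : compatible m phi ->
  standard (rk N) v setT set0 m = stdfun N BB phi.
Proof.
move=> [mphi phi0].
have supE i : under v (supp m :|: set0) (v i) = fsup phi (v i).
  rewrite setU0; apply/setP => x; apply/bigcupP/bigcupP => -[].
    by move=> j /andP[]; rewrite inE mphi => h1 h2 xj; exists (v j); rewrite ?h1.
  move=> C /andP[C0 lt] xC; have CB : C \in BB.
    by apply: contraNT C0 => /phi0 ->.
  exists (enum_rank_in CB C); rewrite /v ?enum_rankK_in //.
  by rewrite inE mphi /v enum_rankK_in // C0.
rewrite /standard subsetT /=; apply/forall_inP/stdfunP => [h|[h1 h2] i _].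
  split=> // B hB; have := h (enum_rank_in hB B) (in_setT _).
  by rewrite /codegree supE mphi /v enum_rankK_in.
by rewrite /codegree supE mphi; apply: h1; apply: enum_valP.
Qed.

Lemma compatible_deg m phi : compatible m phi -> mdeg m = fdeg phi.
Proof.
move=> [mphi phi0]; rewrite mdegE /fdeg (bigID (mem BB)) /=.
rewrite [X in (_ + X)%N]big1 ?addn0; last by move=> B /phi0.
by rewrite [RHS]big_enum_val; apply: eq_bigr => i _; rewrite mphi.
Qed.

Lemma card_standard d :
  #|[set m : 'X_{1..#|BB| < d.+1} | standard (rk N) v setT set0 m & mdeg m == d]|
  = #|[set phi | stdfun N BB phi & fdeg phi == d]|.
Proof.
(* At most one index contributes to the inner sum, which is empty, hence 0, outside [BB]. *)
pose fm (m : 'X_{1..#|BB| < d.+1}) : {ffun {set T} -> 'I_L.+1} :=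
  [ffun B => inord (\sum_(i < #|BB| | v i == B) val m i)].
have fm_comp (m : 'X_{1..#|BB| < d.+1}) :
    standard (rk N) v setT set0 m -> compatible m (fm m).
  case/andP=> _ /forall_inP stdm; split=> [i|B hB]; rewrite ffunE; last first.
    rewrite big1 ?inordK // => i /eqP vi; case/negP: hB.
    by rewrite -vi; apply: enum_valP.
  rewrite (bigD1 i) //= big1 ?addn0 => [|j /andP[/eqP /enum_val_inj -> ]]; last first.
    by rewrite eqxx.
  rewrite inordK // ltnS; apply: leq_trans (rkL (enum_valP i)).
  by apply: ltnW; apply: leq_trans (stdm i (in_setT i)) _; apply: leq_subr.
rewrite -(@card_in_imset _ _ fm); last first.
  move=> m m'; rewrite !inE => /andP[/fm_comp[c1 _] _] /andP[/fm_comp[c2 _] _] eqf.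
  by apply/val_inj/mnmP => i; rewrite c1 c2 eqf.
apply: eq_card => phi; apply/imsetP/idP.
  move=> [m]; rewrite !inE => /andP[stdm dm] ->.
  by rewrite -(compatible_standard (fm_comp _ stdm)) stdm -(compatible_deg (fm_comp _ stdm)).
rewrite inE => /andP[stdphi /eqP dphi].
pose m : 'X_{1..#|BB|} := [multinom (phi (v i) : nat) | i < #|BB|].
have cm : compatible m phi.
  by split=> [i|]; [rewrite mnmE | case/stdfunP: stdphi].
have dm : mdeg m = d by rewrite (compatible_deg cm).
have ltm : (mdeg m < d.+1)%N by rewrite dm.
have stdm : standard (rk N) v setT set0 m by rewrite (compatible_standard cm).
exists (BMultinom ltm); first by rewrite inE stdm dm eqxx.
have [c1 c2] := fm_comp (BMultinom ltm) stdm.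
apply/ffunP => B; apply: ord_inj; have [hB|hB] := boolP (B \in BB); last first.
  by rewrite c2 //; case/stdfunP: stdphi => _ /(_ B hB).
have := c1 (enum_rank_in hB B); rewrite /v enum_rankK_in // => <-.
by rewrite mnmE /v enum_rankK_in.
Qed.

Lemma chow_hilbert_std :
  chow_hilbert N BB = \sum_(phi | stdfun N BB phi) 'X^(fdeg phi).
Proof.
apply/polyP => d; rewrite coef_chow_hilbert coef_sum.
have -> : \sum_(phi | stdfun N BB phi) ('X^(fdeg phi) : {poly rat})`_d
    = #|[set phi | stdfun N BB phi & fdeg phi == d]|%:R.
  rewrite -sum1_card natr_sum big_mkcond [RHS]big_mkcond /=.
  apply: eq_bigr => phi _; rewrite inE coefXn eq_sym.
  by case: (stdfun _ _ _); case: eqP.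
congr (_%:R); rewrite -card_standard.
have vE i : v i \subset gset N by apply/flat_sub/(wb_flat wB)/enum_valP.
apply: (@hilbert_fun_standard _ (gset N) (rk N)).
- by move=> A B; apply: rk_mono.
- by move=> A B; apply: rk_submod.
- exact: vE.
- exact: enum_val_inj.
- by move=> i; apply/(wb_neq0 wB)/enum_valP.
- move=> i j ij0; have jn := wb_join wB (enum_valP i) (enum_valP j) ij0.
  exists (enum_rank_in jn (cl N (v i :|: v j))); rewrite /v enum_rankK_in //.
  split=> [||l]; first exact: sub_cl.
    by rewrite rk_cl // subUset; apply/andP; split; apply: vE.
  by apply: cl_min; apply/(wb_flat wB)/enum_valP.
- move=> p; suff -> : @chow_gen _ N BB = std_gen (rk N) v setT set0 by [].
  apply/funext => -[S i]; rewrite /chow_gen /std_gen /= subsetT inE /=.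
  rewrite /codegree setU0; congr (_ * _ ^+ (_ - _)).
    by apply: eq_bigl => k; rewrite inE.
  rewrite /sup_below rk_cl //; apply/bigcupsP => j _; exact: vE.
Qed.

End Hilbert.
End StandardFunctions.

(** * The convolution over the whole lattice of flats *)

Section TopIdentity.
Variables (T : finType) (M : rankData T) (GG : {set {set T}}).
Hypotheses (pM : polymatroid M) (lM : loopless M) (wG : wbuilding M GG).
Local Notation E := (gset M).
Local Notation rk := (rk M).
Let L := rk E.
Implicit Types (phi psi : {ffun {set T} -> 'I_L.+1}) (A B C F G H K : {set T}).
Local Notation Gm := (maxels (below GG E)).
Let fE : flat M E := flat_gset M.
Local Notation St := (stdfun M GG).

Definition fjoin phi A : {set T} :=
  \bigcup_(C | ((phi C : nat) != 0%N) && (C \subset A)) C.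

Lemma wb_sub G : G \in GG -> G \subset E.
Proof. by move=> /(wb_flat wG) /flat_sub. Qed.

Lemma wb_rk G : G \in GG -> (rk G <= L)%N.
Proof. by move=> /wb_sub sG; apply: rk_mono. Qed.

Lemma St_in phi C : St phi -> (phi C : nat) != 0%N -> C \in GG.
Proof. by case/stdfunP=> _ h; apply: contraNT => /h ->. Qed.

Lemma fjoin_sub phi A : fjoin phi A \subset A.
Proof. by apply/bigcupsP => C /andP[]. Qed.

Lemma minor_building0 H : flat M H -> minor_building M GG set0 H = below GG H.
Proof.
move=> fH; have valE B : B \in GG -> join M B set0 :\: set0 = B.
  by move=> BG; rewrite setD0 /join setU0 cl_flat // (wb_flat wG).
apply/setP => A; rewrite inE; apply/imsetP/andP => [[B]|[AG sA]].
  by rewrite inE => /and3P[BG sB _] ->; rewrite valE.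
by exists A; rewrite ?valE // inE AG sA subset0 (wb_neq0 wG).
Qed.

(** Below [H] the standardness conditions are the same. At a member [B] not below [H] the exponent
    is 0 and the bound is positive, because the support below [B] lies in [B :&: H], a flat properly
    inside [B]. *)
Lemma chow_hilbert_lower H : flat M H ->
  chow_hilbert (minor M set0 H) (minor_building M GG set0 H)
  = \sum_(phi | St phi && (fjoin phi E \subset H)) 'X^(fdeg phi).
Proof.
move=> fH; have rk0 : rk set0 = 0%N by case: pM.
have rkE A : Defs.rk (minor M set0 H) A = rk A by rewrite /= setU0 rk0 subn0.
have sH0 := sub0set H.
rewrite (@chow_hilbert_std T L); first last.
- move=> B; rewrite minor_building0 // inE rkE => /andP[BG _]; exact: wb_rk.
- exact: wbuilding_minor.
- by apply: minor_polymatroid => //; apply: flat_sub.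
apply: eq_bigl => phi; rewrite minor_building0 //.
apply/stdfunP/andP => [[h1 h0]|[stdphi sJ]].
  have inH C : (phi C : nat) != 0%N -> C \in GG /\ C \subset H.
    move=> C0; apply/andP; have : C \in below GG H by apply: contraNT C0 => /h0 ->.
    by rewrite inE.
  split; last by apply/bigcupsP => C /andP[/inH[]].
  apply/stdfunP; split=> B BG; last first.
    by apply: h0; rewrite inE (negPf BG).
  have [sB|nB] := boolP (B \subset H).
    by have := h1 B; rewrite !rkE inE BG sB; apply.
  rewrite h0 ?inE ?(negPf nB) ?andbF // subn_gt0.
  have fB := wb_flat wG BG; have fBH : flat M (B :&: H) by apply: flatI.
  apply: (@leq_ltn_trans (rk (B :&: H))).
    apply: rk_mono => //; last exact: flat_sub.
    apply/bigcupsP => C /andP[/inH[_ sCH] /proper_sub sCB].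
    by rewrite subsetI sCB.
  rewrite ltnNge; apply: contra nB => le.
  have -> := flat_rk_eq pM fBH (subsetIl B H) (wb_sub BG) le.
  exact: subsetIr.
have /stdfunP[s1 s0] := stdphi; split=> B.
  by rewrite inE !rkE => /andP[BG _]; apply: s1.
rewrite inE negb_and => /orP[/s0 //|nB]; apply/eqP; apply: contraNT nB => B0.
apply: subset_trans sJ; apply: (bigcup_max B) => //.
by rewrite B0 wb_sub // (St_in stdphi).
Qed.

Lemma fjoin_split phi H : St phi ->
  (fjoin phi E \subset H) = [forall G in Gm, fjoin phi G \subset H].
Proof.
move=> sphi; apply/idP/forall_inP => [h G Gi|h].
  apply: subset_trans h; apply/bigcupsP => C /andP[C0 sCG].
  by apply: (bigcup_max C) => //; rewrite C0 wb_sub // (St_in sphi).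
apply/bigcupsP => C /andP[C0 sCE].
have [G Gi sCG] := comp_above (St_in sphi C0) sCE.
by apply: subset_trans (h G Gi); apply: (bigcup_max C) => //; rewrite C0.
Qed.

(** Distributivity along the bijection between flats and families of flats of the components, given
    by traces one way and closure of the union the other. *)
Lemma flat_comp_sum (R : comNzRingType) (A : {set T} -> {set T})
    (u : {set T} -> {set T} -> R) :
    (forall G, G \in Gm -> A G \subset G) ->
  \sum_(H | flat M H && [forall G in Gm, A G \subset H]) \prod_(G in Gm) u G (H :&: G)
  = \prod_(G in Gm) \sum_(K | [&& flat M K, A G \subset K & K \subset G]) u G K.
Proof.
move=> sA; rewrite (big_distr_big_dep set0) /=.
pose h (f : {ffun {set T} -> {set T}}) := cl M (\bigcup_(G in Gm) f G).
pose h' H : {ffun {set T} -> {set T}} :=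
  [ffun G => if G \in Gm then H :&: G else set0].
rewrite (reindex_onto h h') /=; last first.
  move=> H /andP[fH _]; rewrite /h -[RHS](flat_decomp pM wG fE fH (flat_sub fH)).
  by congr (cl M _); apply: eq_bigr => G Gi; rewrite ffunE Gi.
have hP (f : {ffun {set T} -> {set T}}) :
    f \in pfamily set0 Gm (fun G K => [&& flat M K, A G \subset K & K \subset G]) ->
    (forall G, G \in Gm -> f G \subset G) /\ (forall G, G \in Gm -> h f :&: G = f G).
  move=> /pfamilyP[_ hf]; have sf G : G \in Gm -> f G \subset G.
    by move=> /hf /and3P[].
  split=> // G Gi; apply: (cl_bigcup_compI pM wG fE sf) => //.
  by case/and3P: (hf G Gi).
apply: eq_big => [f|f].
  apply/andP/idP => [[/andP[fh /forall_inP hA] /eqP hK]|ff].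
    apply/pfamilyP; split.
      apply/subsetP => G; rewrite inE -hK ffunE.
      by case: (G \in Gm) => //; rewrite eqxx.
    move=> G Gi; rewrite -hK ffunE Gi; apply/and3P; split.
    - by apply: flatI => //; apply: comp_flat Gi.
    - by rewrite subsetI hA //= sA.
    - exact: subsetIr.
  have [sf fI] := hP f ff; have /pfamilyP[/subsetP supf hf] := ff.
  have sfE := bigcup_comp_subE fE sf.
  split; last first.
    apply/eqP/ffunP => G; rewrite ffunE; case: ifP => [Gi|nG]; first exact: fI.
    by apply/esym/eqP; apply: contraFT nG => f0; apply: supf.
  apply/andP; split; first exact: flat_cl.
  apply/forall_inP => G Gi; have /and3P[_ sAf _] := hf G Gi.
  apply: subset_trans sAf _; rewrite -(fI G Gi); exact: subsetIl.
move=> /andP[_ /eqP hK]; apply: eq_bigr => G Gi.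
by rewrite -[in RHS]hK ffunE Gi.
Qed.

(** Instead of factoring the Möbius function, the sums of both sides over the flats above any [F]
    are compared: both equal ['X] to the corank of [F], and [up_sum_inj] concludes. *)
Lemma char_poly_comp H : flat M H ->
  char_poly_pm (minor M H E) = \prod_(G in Gm) char_poly_pm (minor M (H :&: G) G).
Proof.
move: H; apply: (up_sum_inj (M := M)) => F fF.
have sFE := flat_sub fF.
rewrite (eq_bigl (fun H => [&& flat M H, F \subset H & H \subset E])); last first.
  move=> H; case: (boolP (flat M H)) => //= fH.
  by rewrite (flat_sub fH) andbT.
rewrite char_poly_sum //.
rewrite (eq_bigl (fun H => flat M H && [forall G in Gm, F :&: G \subset H])); last first.
  move=> H; case: (boolP (flat M H)) => //= fH.
  apply/idP/forall_inP => [sFH G _|h].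
    by apply: subset_trans sFH; apply: subsetIl.
  have <- := flat_decomp pM wG fE fF sFE; apply: cl_min => //.
  exact/bigcupsP.
rewrite (flat_comp_sum (A := fun G => F :&: G)
  (fun G K => char_poly_pm (minor M K G))); last by move=> G _; apply: subsetIr.
rewrite (eq_bigr (fun G => 'X^(rk G - rk (F :&: G)))); last first.
  move=> G Gi; have fG := comp_flat wG Gi.
  by rewrite char_poly_sum ?subsetIr //; apply: flatI.
rewrite -(big_morph _ (@exprD _ 'X) (expr0 _)) sumnB; last first.
  move=> G Gi; apply: rk_mono; rewrite ?subsetIr //.
  exact: flat_sub (comp_flat wG Gi).
by rewrite -(rk_comp wG fE) -(rk_decomp pM wG fE fF sFE).
Qed.

Lemma card_maxels_minor H : flat M H ->
  #|maxels (minor_building M GG H E)| = #|[set G in Gm | ~~ (G \subset H)]|.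
Proof.
move=> fH; have sHE := flat_sub fH.
have -> : minor_building M GG H E = below (minor_building M GG H E) (E :\: H).
  apply/setP => A; rewrite inE; apply/esym/andb_idr.
  case/minor_buildingP=> B [BG sB nB ->]; apply: setSD; apply: cl_sub.
  by rewrite subUset sHE sB.
rewrite maxels_minor // card_in_imset //.
exact: minor_comp_inj.
Qed.

Local Notation t := (@tofrac {poly rat}).

Lemma frac_1subX_neq0 : t (1 - 'X) != 0.
Proof.
rewrite tofrac_eq0; apply/eqP => /polyP/(_ 1%N).
by rewrite coefB coef1 coefX coef0 /= sub0r => /eqP; rewrite oppr_eq0 oner_eq0.
Qed.

Lemma char_poly_minor_refl G : flat M G -> char_poly_pm (minor M G G) = 1.
Proof.
move=> fG; have := char_poly_sum pM fG fG (subxx G); rewrite subnn expr0 => <-.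
rewrite (bigD1 G) ?fG ?subxx //= big1 ?addr0 // => H.
case/andP=> /and3P[_ h1 h2] /eqP[]; apply/eqP.
by rewrite eqEsubset h1 h2.
Qed.

(** The numerators add up to ['X^(rk G - rk A)]. The term [K = G] is 1 with no denominator, that is
    [(1 - x)/(1 - x)] in place of [1/(1 - x)]; this accounts for the [- 'X]. *)
Lemma reduced_char_sum G A : flat M G -> A \subset G ->
  \sum_(K | [&& flat M K, A \subset K & K \subset G])
     t (char_poly_pm (minor M K G)) / (if G \subset K then 1 else t (1 - 'X))
  = t ('X^(rk G - rk A) - 'X) / t (1 - 'X).
Proof.
move=> fG sAG; have nz := frac_1subX_neq0; have sAE := subset_trans sAG (flat_sub fG).
have fcl : flat M (cl M A) by apply: flat_cl.
have sclG : cl M A \subset G by apply: cl_min.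
have := char_poly_sum pM fcl fG sclG; rewrite rk_cl //.
rewrite (eq_bigl (fun K => [&& flat M K, A \subset K & K \subset G])); last first.
  by move=> K; case: (boolP (flat M K)) => //= fK; rewrite cl_subE.
rewrite (bigD1 G) ?fG ?sAG ?subxx //= char_poly_minor_refl // => sumE.
rewrite (bigD1 G) ?fG ?sAG ?subxx //= char_poly_minor_refl // rmorph1 divr1.
rewrite (eq_bigr (fun K => t (char_poly_pm (minor M K G)) / t (1 - 'X))); last first.
  move=> K /andP[/and3P[_ _ sKG] nKG]; case: ifP => // sGK.
  by case/eqP: nKG; apply/eqP; rewrite eqEsubset sKG.
rewrite -mulr_suml -rmorph_sum -sumE.
apply: (mulIf nz); rewrite mulrDl !divfK // mul1r -rmorphD; congr (t _).
by rewrite addrAC.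
Qed.

(** * Summation over the exponent of one maximal member *)

Section Cancellation.
Variable G0 : {set T}.
Hypothesis G0m : G0 \in Gm.

Definition set_at phi (k : 'I_L.+1) : {ffun {set T} -> 'I_L.+1} :=
  [ffun B => if B == G0 then k else phi B].

Lemma G0_max B : B \in GG -> ~~ (G0 \proper B).
Proof.
move=> BG; have := G0m; rewrite inE => /andP[_]; apply: contra => lt.
by apply/existsP; exists B; rewrite lt andbT inE BG wb_sub.
Qed.

(** A maximal member is properly below no other, so its exponent enters only its own standardness
    condition. *)
Lemma fsup_set_at phi k B : B \in GG -> fsup (set_at phi k) B = fsup phi B.
Proof.
move=> BG; apply: eq_bigl => C; rewrite ffunE; have [->|//] := eqVneq C G0.
by rewrite (negPf (G0_max BG)) !andbF.
Qed.

Lemma fsup_G0 phi : (phi G0 = 0%N :> nat) -> fsup phi G0 = fjoin phi G0.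
Proof.
move=> p0; apply: eq_bigl => C; rewrite properEneq.
by case: (eqVneq C G0) => // ->; rewrite p0.
Qed.

Lemma fdeg_set_at phi k : (phi G0 = 0%N :> nat) ->
  fdeg (set_at phi k) = (k + fdeg phi)%N.
Proof.
move=> p0; rewrite /fdeg (bigD1 G0) //= ffunE eqxx; congr (_ + _)%N.
rewrite [RHS](bigD1 G0) //= p0 add0n; apply: eq_bigr => B /negPf nB.
by rewrite ffunE nB.
Qed.

Lemma fjoin_set_at phi k G : G \in Gm -> G != G0 ->
  fjoin (set_at phi k) G = fjoin phi G.
Proof.
move=> Gi nG; apply: eq_bigl => C; rewrite ffunE; have [->|//] := eqVneq C G0.
case: (boolP (G0 \subset G)) => [sG|]; last by rewrite !andbF.
by case/eqP: nG; rewrite (maxels_antichain G0m Gi sG).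
Qed.

Lemma set_at_id phi : (phi G0 = 0%N :> nat) -> set_at phi ord0 = phi.
Proof.
move=> p0; apply/ffunP => B; rewrite ffunE; case: eqP => // ->.
exact: ord_inj.
Qed.

Lemma St_set_at phi k : (phi G0 = 0%N :> nat) ->
  St (set_at phi k) = St phi && (k < rk G0 - rk (fjoin phi G0))%N.
Proof.
move=> p0; have G0G : G0 \in GG := comp_in G0m.
apply/stdfunP/andP => [[h1 h0]|[/stdfunP[h1 h0] ltk]].
  have lt := h1 G0 G0G; rewrite fsup_set_at // ffunE eqxx fsup_G0 // in lt.
  split=> //; apply/stdfunP; split=> B BG.
    have [->|nB] := eqVneq B G0; first by rewrite p0 fsup_G0 // (leq_ltn_trans _ lt).
    by have := h1 B BG; rewrite fsup_set_at // ffunE (negPf nB).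
  have := h0 B BG; rewrite ffunE; case: eqP => // BG0.
  by rewrite BG0 G0G in BG.
split=> B BG; rewrite ?fsup_set_at // ffunE; have [BG0|_] := eqVneq B G0.
- by rewrite BG0 fsup_G0.
- exact: h1.
- by rewrite BG0 G0G in BG.
- exact: h0.
Qed.

(** With [1 - 'X] in every term the sum telescopes to [1 - 'X^a]; the actual factor at [k = 0]
    exceeds it by ['X^a - 1]. *)
Lemma geometric_cancel (a : nat) : (0 < a)%N ->
  \sum_(k < a) 'X^k * (if (k : nat) == 0%N then 'X^a - 'X else 1 - 'X) = 0 :> {poly rat}.
Proof.
case: a => // a _; rewrite (bigD1 ord0) //= expr0 mul1r.
have : \sum_(k < a.+1) 'X^k * (1 - 'X) = 1 - 'X^(a.+1) :> {poly rat}.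
  by rewrite -mulr_suml mulrC -opprB mulNr -subrX1 opprB.
rewrite (bigD1 ord0) //= expr0 mul1r => /eqP; rewrite addrC eq_sym -subr_eq => /eqP E1.
rewrite (eq_bigr (fun k : 'I_a.+1 => 'X^k * (1 - 'X))).
  by rewrite -E1; ring.
by move=> k k0; rewrite ifN.
Qed.

Lemma standard_cancel :
  \sum_(phi | St phi) 'X^(fdeg phi) *
     \prod_(G in Gm) ('X^(rk G - rk (fjoin phi G)) - 'X) = 0 :> {poly rat}.
Proof.
rewrite (partition_big (fun phi => set_at phi ord0)
  (fun psi => St psi && ((psi G0 : nat) == 0%N))) /=; last first.
  move=> phi sphi; have z0 : set_at phi ord0 G0 = 0%N :> nat
    by rewrite ffunE eqxx.
  rewrite z0 eqxx andbT; have phiE : phi = set_at (set_at phi ord0) (phi G0).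
    by apply/ffunP => B; rewrite !ffunE; case: eqP => [->|].
  by move: sphi; rewrite {1}phiE St_set_at // => /andP[].
apply: big1 => psi /andP[spsi /eqP p0].
set a := (rk G0 - rk (fjoin psi G0))%N.
pose c := \prod_(G in Gm | G != G0) ('X^(rk G - rk (fjoin psi G)) - 'X) : {poly rat}.
have G0G : G0 \in GG := comp_in G0m.
have apos : (0 < a)%N.
  have /stdfunP[/(_ G0 G0G) + _] := spsi; rewrite fsup_G0 //.
  by apply: leq_trans.
(* All exponents [k < a] are available in ['I_L.+1], so the fibre over [psi] is the full range. *)
have aL : (a <= L.+1)%N.
  by apply: leqW; apply: leq_trans (leq_subr _ _) _; apply: wb_rk.
rewrite (reindex_onto (set_at psi) (fun phi => phi G0)) /=; last first.
  move=> phi /andP[_ /eqP <-]; apply/ffunP => B; rewrite !ffunE.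
  by case: eqP => [->|].
rewrite (eq_bigl (fun k : 'I_L.+1 => (k < a)%N)); last first.
  move=> k; rewrite St_set_at // spsi /= ffunE eqxx eqxx andbT.
  apply/andb_idr => _; apply/eqP/ffunP => B; rewrite !ffunE.
  by case: eqP => // ->; apply: ord_inj.
rewrite (eq_bigr (fun k : 'I_L.+1 => 'X^(fdeg psi) * c *
   ('X^k * (if (k : nat) == 0%N then 'X^a - 'X else 1 - 'X)))); last first.
  move=> k ltk; rewrite fdeg_set_at // exprD (bigD1 G0) //=.
  rewrite (eq_bigr (fun G => 'X^(rk G - rk (fjoin psi G)) - 'X)); last first.
    by move=> G /andP[Gi nG]; rewrite fjoin_set_at.
  rewrite -/c.
  (* A positive exponent puts [G0] itself into [fjoin], which then fills [G0] and leaves corank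
     0. *)
  have -> : 'X^(rk G0 - rk (fjoin (set_at psi k) G0)) - 'X
      = (if (k : nat) == 0%N then 'X^a - 'X else 1 - 'X) :> {poly rat}.
    case: eqP => k0.
      have -> : k = ord0 by apply: ord_inj.
      by rewrite set_at_id.
    have -> : fjoin (set_at psi k) G0 = G0.
      apply/eqP; rewrite eqEsubset fjoin_sub; apply: (bigcup_max G0) => //.
      by rewrite ffunE eqxx subxx andbT; apply/eqP.
    by rewrite subnn expr0.
  by rewrite mulrACA mulrC.
rewrite -mulr_sumr -(big_ord_widen _ (fun k : nat =>
  'X^k * (if k == 0%N then 'X^a - 'X else 1 - 'X)) aL).
by rewrite geometric_cancel // mulr0.
Qed.

End Cancellation.

Lemma chow_reduced_char_top : E != set0 ->
  \sum_(H | flat M H)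
    t (chow_hilbert (minor M set0 H) (minor_building M GG set0 H)) *
    (t (char_poly_pm (minor M H E))
       / t (1 - 'X) ^+ #|maxels (minor_building M GG H E)|) = 0.
Proof.
move=> E0; have nz := frac_1subX_neq0.
have [G0 G0m] : exists G, G \in Gm.
  apply/set0Pn; apply: contraNneq E0 => Gm0.
  by rewrite -(cl_comp wG fE) Gm0 big_set0 cl_flat.
pose u G K := t (char_poly_pm (minor M K G)) / (if G \subset K then 1 else t (1 - 'X)).
(* The exponent of [1 - 'X] counts the components not inside [H], so the denominator distributes
   over the components as well. *)
have termE H : flat M H -> t (char_poly_pm (minor M H E))
       / t (1 - 'X) ^+ #|maxels (minor_building M GG H E)|
    = \prod_(G in Gm) u G (H :&: G).
  move=> fH; rewrite char_poly_comp // card_maxels_minor // rmorph_prod /=.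
  rewrite /u big_split /=; congr (_ * _); rewrite prodfV; congr (_^-1).
  rewrite -prodr_const [LHS](eq_bigl (fun G => (G \in Gm) && ~~ (G \subset H))); last first.
    by move=> G; apply: in_set.
  rewrite big_mkcondr /=; apply: eq_bigr => G Gi.
  by rewrite subsetI subxx andbT if_neg.
rewrite (eq_bigr (fun H => \sum_(phi | St phi && (fjoin phi E \subset H))
    t 'X^(fdeg phi) * \prod_(G in Gm) u G (H :&: G))); last first.
  by move=> H fH; rewrite chow_hilbert_lower // rmorph_sum termE // mulr_suml.
rewrite (exchange_big_dep St) /=; last by move=> H phi _ /andP[].
rewrite (eq_bigr (fun phi => t ('X^(fdeg phi) *
    \prod_(G in Gm) ('X^(rk G - rk (fjoin phi G)) - 'X)) / t (1 - 'X) ^+ #|Gm|)).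
  by rewrite -mulr_suml -rmorph_sum (standard_cancel G0m) rmorph0 mul0r.
move=> phi sphi; rewrite -mulr_sumr rmorphM -mulrA; congr (_ * _).
rewrite (eq_bigl (fun H => flat M H && [forall G in Gm, fjoin phi G \subset H])); last first.
  by move=> H; rewrite sphi fjoin_split.
rewrite flat_comp_sum; last by move=> G _; apply: fjoin_sub.
rewrite (eq_bigr (fun G => t ('X^(rk G - rk (fjoin phi G)) - 'X) / t (1 - 'X))); last first.
  by move=> G Gi; apply: reduced_char_sum; [apply: comp_flat Gi | apply: fjoin_sub].
by rewrite big_split /= prodr_const rmorph_prod exprVn.
Qed.

End TopIdentity.

(** * Arbitrary intervals and the incidence algebra *)

Section Inverse.
Variables (T : finType) (M : rankData T) (GG : {set {set T}}).
Hypotheses (pM : polymatroid M) (wG : wbuilding M GG).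
Implicit Types (F G H : {set T}).
Local Notation Qx := {fraction {poly rat}}.
Local Notation t := (@tofrac {poly rat}).

(** No separate clause on the diagonal: the general formulas already give 1 there, which lets them
    be compared with the identity for minors term by term. *)
Definition chow_entry F G : Qx :=
  t (chow_hilbert (minor M F G) (minor_building M GG F G)).

Definition char_entry F G : Qx :=
  t (char_poly_pm (minor M F G)) / t (1 - 'X) ^+ #|maxels (minor_building M GG F G)|.

Lemma minor_building_refl F : minor_building M GG F F = set0.
Proof.
apply/setP => A; rewrite !inE; apply/negP => /imsetP[H].
by rewrite inE => /and3P[_ ->].
Qed.

Lemma chow_entry_refl F : flat M F -> chow_entry F F = 1.
Proof.
move=> fF; rewrite /chow_entry (@chow_hilbert_std T 0); first last.
- by move=> B; rewrite minor_building_refl inE.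
- exact: wbuilding_minor.
- by apply: minor_polymatroid => //; apply: flat_sub.
rewrite (big_pred1 [ffun=> ord0]) => [|phi].
  by rewrite /fdeg big1 ?expr0 ?rmorph1 // => B _; rewrite ffunE.
rewrite minor_building_refl; apply/stdfunP/eqP => [_|->].
  by apply/ffunP => B; apply: ord_inj; rewrite (ord1 (phi B)) (ord1 (_ B)).
by split=> B; rewrite ?inE // ffunE.
Qed.

Lemma char_entry_refl F : flat M F -> char_entry F F = 1.
Proof.
move=> fF; rewrite /char_entry char_poly_minor_refl // minor_building_refl.
have -> : maxels (set0 : {set {set T}}) = set0.
  by apply/eqP; rewrite -subset0 maxels_sub.
by rewrite cards0 expr0 rmorph1 divr1.
Qed.

Lemma chow_char_entry F G : flat M F -> flat M G -> F \subset G ->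
  \sum_(H | [&& flat M H, F \subset H & H \subset G])
     chow_entry F H * char_entry H G = (F == G)%:R.
Proof.
move=> fF fG sFG; have [<-|neq] := eqVneq F G.
  rewrite (bigD1 F) ?fF ?subxx //= chow_entry_refl // char_entry_refl // mulr1.
  rewrite big1 ?addr0 // => H /andP[/and3P[_ h1 h2]] /eqP[].
  by apply/eqP; rewrite eqEsubset h1 h2.
have GF0 : gset (minor M F G) != set0.
  by rewrite setD_eq0; apply: contra neq => sGF; rewrite eqEsubset sFG.
have := chow_reduced_char_top (minor_pm pM fG sFG) (minor_loopless pM fF fG sFG)
  (wbuilding_minor pM wG fF fG sFG) GF0.
rewrite (eq_bigl (fun A => flat (minor M F G) A && xpredT A)); last first.
  by move=> A; rewrite andbT.
rewrite big_minor // => sum0; rewrite -[RHS]sum0.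
apply: eq_big => [H|H /and3P[fH sFH sHG]]; first by rewrite andbT.
have fHN := minor_flatD pM fF fG sFG fH sFH sHG.
have f0N := minor_loopless pM fF fG sFG.
have fGN : flat (minor M F G) (G :\: F) := flat_gset _.
have sHN := minor_flat_sub fHN.
(* Minors of [minor M F G] and their building sets are those of [M], so its top identity is the
   convolution at [(F, G)]. *)
rewrite /= (minor_minor pM fG sFG (sub0set _) sHN).
rewrite (minor_minor pM fG sFG sHN (subxx _)).
rewrite (minor_building_minor GG pM fF fG sFG f0N fHN (sub0set _)).
rewrite (minor_building_minor GG pM fF fG sFG fHN fGN sHN).
by rewrite set0U !setDUK.
Qed.

Lemma inc_coef_fun (f : {set T} -> {set T} -> Qx) F G :
  flat M F -> flat M G -> F \subset G -> inc_coef (inc_fun M f) F G = f F G.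
Proof.
move=> fF fG sFG; rewrite /inc_coef.
by case: insubP => [u _ uE|]; rewrite /= ?ffunE ?uE // fF fG sFG.
Qed.

Lemma eq_inc_fun (f g : {set T} -> {set T} -> Qx) :
    (forall F G, flat M F -> flat M G -> F \subset G -> f F G = g F G) ->
  inc_fun M f = inc_fun M g.
Proof.
move=> fg; apply/ffunP => u; rewrite !ffunE.
by have /and3P[? ? ?] := valP u; apply: fg.
Qed.

Lemma inc_mul_fun (f g : {set T} -> {set T} -> Qx) :
  inc_mul (inc_fun M f) (inc_fun M g) =
  inc_fun M (fun F G =>
    \sum_(H | [&& flat M H, F \subset H & H \subset G]) f F H * g H G).
Proof.
apply: eq_inc_fun => F G fF fG sFG; apply: eq_bigr => H /and3P[fH sFH sHG].
by rewrite !inc_coef_fun.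
Qed.

Lemma chow_funE : chow_fun M GG = inc_fun M chow_entry.
Proof.
apply: eq_inc_fun => F G fF fG sFG; case: eqP => // <-.
by rewrite chow_entry_refl.
Qed.

Lemma reduced_charE : reduced_char M GG = inc_fun M (fun F G => - char_entry F G).
Proof.
apply: eq_inc_fun => F G fF fG sFG; case: eqP => // <-.
by rewrite char_entry_refl.
Qed.

Lemma inc_funN (f : {set T} -> {set T} -> Qx) :
  - inc_fun M f = inc_fun M (fun F G => - f F G).
Proof. by apply/ffunP => u; rewrite !ffunE. Qed.

Lemma reduced_char_inverse : inc_inverse (reduced_char M GG) (- chow_fun M GG).
Proof.
rewrite chow_funE reduced_charE inc_funN; split; rewrite inc_mul_fun.
  apply: eq_inc_fun => F G fF fG sFG; under eq_bigr do rewrite mulrNN.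
  (* Only the product in the other order was computed; this one follows from invertibility of square
     matrices. *)
  by apply: flat_convC fF fG sFG; apply: chow_char_entry.
apply: eq_inc_fun => F G fF fG sFG; under eq_bigr do rewrite mulrNN.
exact: chow_char_entry.
Qed.

End Inverse.

Theorem theorem3p6 (T : finType) (M : rankData T) (GG : {set {set T}}) :
  polymatroid M -> loopless M -> building_set M GG ->
  exists chi_inv : incidence M,
    inc_inverse (reduced_char M GG) chi_inv /\ chow_fun M GG = - chi_inv.
Proof.
move=> pM lM bG; exists (- chow_fun M GG); split; last by rewrite opprK.
by apply: reduced_char_inverse => //; apply: building_wbuilding.
Qed.
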